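(* Let $G$ be a countably based residually-(finite perfect) group. Then there exists a layered branch group $\Gamma$ which contains a subgroup isomorphic to $G$ and for which there is an injective map from the set of non-normal maximal subgroups of $G$ (i.e. maximal subgroups of $G$ that are not normal in $G$) into the set of maximal subgroups of $\Gamma$. Moreover, if $G$ is finitely generated, then so is $\Gamma$ (that is, $\Gamma$ can be chosen to be a finitely generated layered branch group which contains a subgroup isomorphic to $G$ and for which there is an injective map from the set of non-normal maximal subgroups of $G$ into the set of maximal subgroups of $\Gamma$).
   Context: Residually-(finite perfect). Let $\mathcal{C}$ be the class of finite perfect groups. A $\mathcal{C}$-residual representation of a group $G$ is a homomorphism $\varphi\colon G\to\prod_{i\in I}S_i$ with $S_i\in\mathcal{C}$ for all $i\in I$ such that the image of $G$ is a subdirect product (it projects onto every factor $S_i$). It is countably based if $I$ is countable (one then assumes $I=\{1,2,3,\dots\}$ without loss of generality). $G$ is countably based residually-(finite perfect) if it admits a faithful (injective) countably based $\mathcal{C}$-residual representation. Rooted trees. Let $(X_n)_{n\ge 1}$ be a sequence of finite sets of cardinality at least $2$. The associated rooted tree $T$ has as vertices all finite strings $x_1\dots x_n$ with $n\ge 0$, $x_i\in X_i$, with edges between $x_1\dots x_n$ and $x_1\dots x_nx_{n+1}$; the empty string is the root. The length of a string $v$ is denoted $|v|$, and the $n$-th layer $\mathcal{L}_T(n)$ is the set of vertices of length $n$. $T.\sigma^n$ denotes the rooted tree of the shifted sequence $(X_{n+m})_{m\ge1}$. $\mathrm{Aut}(T)$ is the group of automorphisms of the rooted tree $T$, acting from the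 right. For $g\in\mathrm{Aut}(T)$ and a vertex $v$, the section $g|_v\in\mathrm{Aut}(T.\sigma^{|v|})$ is defined by $(vw).g=(v.g)(w.g|_v)$ for all strings $w$ in $T.\sigma^{|v|}$. Branch and layered groups. A group $\Gamma\le\mathrm{Aut}(T)$ is spherically transitive if it acts transitively on every layer of $T$. The rigid vertex stabiliser $\mathrm{rist}_\Gamma(v)$ consists of all $g\in\Gamma$ fixing $\mathcal{L}_T(|v|)$ pointwise with $g|_u=\mathrm{id}$ for all $u\in\mathcal{L}_T(|v|)\smallsetminus\{v\}$, and $\mathrm{Rist}_\Gamma(n)=\langle\mathrm{rist}_\Gamma(v)\mid v\in\mathcal{L}_T(n)\rangle$. $\Gamma$ is a branch group if it is spherically transitive and $\mathrm{Rist}_\Gamma(n)$ has finite index in $\Gamma$ for all $n\ge0$. For $h\in\mathrm{Aut}(T.\sigma^{|v|})$, let $\mathrm{ins}_v(h)$ be the unique element of $\mathrm{rist}_{\mathrm{Aut}(T)}(v)$ with section $h$ at $v$. $\Gamma$ is layered if $\mathrm{ins}_v(g|_v)\in\Gamma$ for all $g\in\Gamma$ and all vertices $v$ of $T$. A ''layered branch group'' is a subgroup of $\mathrm{Aut}(T)$, for some such rooted tree $T$, that is both a branch group and layered. *)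

(* Defs.v *)
From HB Require Import structures.
From mathcomp Require Import all_boot fingroup finmap.
From mathcomp Require Import boolp classical_sets functions cardinality.

Set Implicit Arguments.
Unset Strict Implicit.
Unset Printing Implicit Defensive.

Definition perfect_group (S : finGroupType) : Prop :=
  ([~: [set: S]%G, [set: S]%G] = [set: S]%G :> {set S})%g.

Local Open Scope classical_set_scope.
Local Open Scope group_scope.

Section Subgroups.
Variable M : groupType.
Implicit Types H K L : set M.

Definition is_subgroup H : Prop :=
  [/\ H 1, forall x y, H x -> H y -> H (x * y) & forall x, H x -> H x^-1].

Definition subgroup_generated (E : set M) : set M :=
  [set x | forall H, is_subgroup H -> E `<=` H -> H x].

Definition finitely_generated K : Prop :=
  exists2 E : set M, finite_set E & K = subgroup_generated E.

Definition maximal_subgroup K H : Prop :=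
  [/\ is_subgroup H, H `<` K &
      forall L, is_subgroup L -> H `<=` L -> L `<=` K -> L = H \/ L = K].

Definition normal_in K H : Prop :=
  H `<=` K /\ forall x y, H x -> K y -> H (x ^ y).

Definition finite_index K H : Prop :=
  H `<=` K /\ finite_set [set [set h * k | h in H] | k in K].

End Subgroups.

Definition isomorphic_to (G M : groupType) (H : set M) : Prop :=
  exists2 f : {multiplicative G -> M}, injective f & [set f x | x in setT] = H.

Definition direct_product (I : Type) (S : I -> groupType) : Type :=
  forall i, S i.

Section DirectProduct.
Variables (I : Type) (S : I -> groupType).
Local Notation P := (direct_product S).

HB.instance Definition _ := gen_eqMixin P.
HB.instance Definition _ := gen_choiceMixin P.

Let dp_one : P := fun i => 1.
Let dp_inv (x : P) : P := fun i => (x i)^-1.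
Let dp_mul (x y : P) : P := fun i => x i * y i.

Fact dp_mulA : associative dp_mul.
Proof. by move=> x y z; apply: functional_extensionality_dep => i; exact: mulgA. Qed.
Fact dp_mul1 : left_id dp_one dp_mul.
Proof. by move=> x; apply: functional_extensionality_dep => i; exact: mul1g. Qed.
Fact dp_mulr1 : right_id dp_one dp_mul.
Proof. by move=> x; apply: functional_extensionality_dep => i; exact: mulg1. Qed.
Fact dp_mulV : left_inverse dp_one dp_inv dp_mul.
Proof. by move=> x; apply: functional_extensionality_dep => i; exact: mulVg. Qed.
Fact dp_mulrV : right_inverse dp_one dp_inv dp_mul.
Proof. by move=> x; apply: functional_extensionality_dep => i; exact: mulgV. Qed.

HB.instance Definition _ :=
  isGroup.Build P dp_mulA dp_mul1 dp_mulr1 dp_mulV dp_mulrV.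

End DirectProduct.

(* The last condition says that the image of [phi] is a subdirect product. *)
Definition finite_perfect_residual_representation (G : groupType) (I : Type)
    (S : I -> finGroupType)
    (phi : {multiplicative G -> direct_product (fun i => S i : groupType)}) :
    Prop :=
  (forall i, perfect_group (S i)) /\
  (forall i (s : S i), exists g : G, phi g i = s).

Definition countably_based_residually_finite_perfect (G : groupType) : Prop :=
  exists (I : countType) (S : I -> finGroupType)
    (phi : {multiplicative G -> direct_product (fun i => S i : groupType)}),
    finite_perfect_residual_representation phi /\ injective phi.

(* The alphabets are finite subsets of an ambient type of letters [A], so that
   a string is a [seq A] for the original as well as for the shifted tree and
   concatenation is [++].  Indexing starts from 0: [X n] is $X_{n+1}$. *)

Section Trees.
Variable A : choiceType.
Implicit Types (X : nat -> {fset A}) (s t : seq A) (n : nat).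

Definition tree_alphabets X : Prop := forall n, (2 <= #|` X n|)%N.

Definition shift_tree n X : nat -> {fset A} := fun m => X (n + m)%N.

Fixpoint is_string X s : bool :=
  if s is x :: s' then (x \in X 0) && is_string (shift_tree 1 X) s' else true.

Record vertex X := Vertex { string_of : seq A; _ : is_string X string_of }.

HB.instance Definition _ X := [isSub for @string_of X].
HB.instance Definition _ X := [Choice of vertex X by <:].

Definition root_vertex X : vertex X := @Vertex X [::] isT.

Definition vlen X (v : vertex X) : nat := size (val v).

Definition layer X n : set (vertex X) := [set v | vlen v = n].
Arguments layer X n : clear implicits.

Definition child X (u v : vertex X) : Prop :=
  exists x : A, val v = rcons (val u) x.

Definition adjacent X (u v : vertex X) : Prop := child u v \/ child v u.

Lemma is_string_cat X s t :
  is_string X (s ++ t) = is_string X s && is_string (shift_tree (size s) X) t.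
Proof. by elim: s X => [//|x s IH] X /=; rewrite IH andbA. Qed.

Lemma vcat_subproof X (v : vertex X) (w : vertex (shift_tree (vlen v) X)) :
  is_string X (val v ++ val w).
Proof. by rewrite is_string_cat (valP v) (valP w). Qed.

Definition vcat X (v : vertex X) (w : vertex (shift_tree (vlen v) X)) : vertex X :=
  Vertex (vcat_subproof w).

Definition is_tree_aut X (f : vertex X -> vertex X) : Prop :=
  [/\ bijective f, f (root_vertex X) = root_vertex X &
      forall u v, adjacent (f u) (f v) <-> adjacent u v].

Record tree_aut X := TreeAut {
  aut_fun :> vertex X -> vertex X;
  aut_funP : is_tree_aut aut_fun }.

Lemma aut_ext X (g h : tree_aut X) : g =1 h -> g = h.
Proof.
case: g h => [f Pf] [f' Pf'] /= /funext eqf; case: _ / eqf in Pf' *.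
by congr TreeAut; exact: Prop_irrelevance.
Qed.

HB.instance Definition _ X := gen_eqMixin (tree_aut X).
HB.instance Definition _ X := gen_choiceMixin (tree_aut X).

Fact aut_one_subproof X : is_tree_aut (@id (vertex X)).
Proof. by split => //; exists id. Qed.
Definition aut_one X : tree_aut X := TreeAut (aut_one_subproof X).

(* Automorphisms act from the right: first [g], then [h]. *)
Fact aut_mul_subproof X (g h : tree_aut X) : is_tree_aut (h \o g).
Proof.
case: (aut_funP g) (aut_funP h) => [bg rg ag] [bh rh ah]; split.
- exact: bij_comp.
- by rewrite /= rg rh.
- by move=> u v /=; apply: (iff_trans (ah _ _)).
Qed.
Definition aut_mul X (g h : tree_aut X) : tree_aut X := TreeAut (aut_mul_subproof g h).

Fact aut_inv_ex X (g : tree_aut X) :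
  exists2 k : tree_aut X, cancel g k & cancel k g.
Proof.
case: (aut_funP g) => [[k gk kg] rg ag].
have kP : is_tree_aut k.
  split; first by exists g.
  - by rewrite -[in LHS]rg gk.
  - by move=> u v; apply: iff_sym; rewrite -{1}(kg u) -{1}(kg v).
by exists (TreeAut kP).
Qed.
Definition aut_inv X (g : tree_aut X) : tree_aut X := s2val (cid2 (aut_inv_ex g)).

Lemma aut_invK X (g : tree_aut X) : cancel g (aut_inv g).
Proof. exact: (s2valP (cid2 (aut_inv_ex g))). Qed.
Lemma aut_invKV X (g : tree_aut X) : cancel (aut_inv g) g.
Proof. exact: (s2valP' (cid2 (aut_inv_ex g))). Qed.

Fact aut_mulA X : associative (@aut_mul X).
Proof. by move=> g h k; exact: aut_ext. Qed.
Fact aut_mul1 X : left_id (aut_one X) (@aut_mul X).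
Proof. by move=> g; exact: aut_ext. Qed.
Fact aut_mulr1 X : right_id (aut_one X) (@aut_mul X).
Proof. by move=> g; exact: aut_ext. Qed.
Fact aut_mulV X : left_inverse (aut_one X) (@aut_inv X) (@aut_mul X).
Proof. by move=> g; apply: aut_ext => v; exact: aut_invKV. Qed.
Fact aut_mulrV X : right_inverse (aut_one X) (@aut_inv X) (@aut_mul X).
Proof. by move=> g; apply: aut_ext => v; exact: aut_invK. Qed.

HB.instance Definition _ X := isGroup.Build (tree_aut X)
  (@aut_mulA X) (@aut_mul1 X) (@aut_mulr1 X) (@aut_mulV X) (@aut_mulrV X).

Lemma child_uniq X (p q v : vertex X) : child p v -> child q v -> p = q.
Proof.
move=> [x e] [y]; rewrite e => /eqP; rewrite eqseq_rcons => /andP[/eqP h _].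
exact: val_inj.
Qed.

Lemma vlen_child X (u v : vertex X) : child u v -> vlen v = (vlen u).+1.
Proof. by move=> [x e]; rewrite /vlen e size_rcons. Qed.

Lemma is_string_rcons X s x :
  is_string X (rcons s x) = is_string X s && (x \in X (size s)).
Proof. by rewrite -cats1 is_string_cat /= /shift_tree addn0 andbT. Qed.

Lemma parent_ex X (v : vertex X) n :
  vlen v = n.+1 -> exists2 p : vertex X, child p v & vlen p = n.
Proof.
case: v => s Hs; rewrite /vlen /=; case: (lastP s) Hs => [//|t x] Hs.
rewrite size_rcons => -[et].
have Ht : is_string X t by move: Hs; rewrite is_string_rcons => /andP[].
by exists (Vertex Ht) => //; exists x.
Qed.

Lemma adj_childr X (u v : vertex X) :
  adjacent u v -> vlen v = (vlen u).+1 -> child u v.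
Proof.
case=> // /vlen_child -> e.
by have : vlen v < (vlen v).+2 by []; rewrite -e ltnn.
Qed.

Lemma aut_child_len X (g : tree_aut X) n :
  (forall u v, vlen u = n -> child u v -> child (g u) (g v))
  /\ (forall u, vlen u = n -> vlen (g u) = n).
Proof.
case: (aut_funP g) => bg rg ag.
have ginj : injective g by exact: bij_inj.
elim: n => [|n [IHc IHl]].
  have root0 u : vlen u = 0 -> u = root_vertex X.
    by move=> /size0nil u0; apply: val_inj.
  split=> [u v /root0 -> cuv|u /root0 ->]; last by rewrite rg.
  have /ag : adjacent (root_vertex X) v by left.
  rewrite rg => -[//|[x]] /=; by case: (val (g v)).
have IHl' u : vlen u = n.+1 -> vlen (g u) = n.+1.
  move=> /parent_ex[p pu pn]; have := IHc _ _ pn pu => /vlen_child ->.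
  by rewrite IHl.
split=> // u v un cuv.
have /ag[//|cgvu] : adjacent u v by left.
have [p pu pn] := parent_ex un.
have /ginj epv := child_uniq cgvu (IHc _ _ pn pu).
move: (vlen_child cuv); rewrite epv pn un => e.
by have : n < n.+2 by []; rewrite -e ltnn.
Qed.

Lemma aut_len X (g : tree_aut X) u : vlen (g u) = vlen u.
Proof. by have [_ ->] := aut_child_len g (vlen u). Qed.

Lemma aut_size X (g : tree_aut X) u : size (val (g u)) = vlen u.
Proof. exact: aut_len. Qed.

Lemma aut_child X (g : tree_aut X) u v : child u v -> child (g u) (g v).
Proof. by have [+ _] := aut_child_len g (vlen u) => /(_ u v erefl). Qed.

Lemma aut_prefix X (g : tree_aut X) (v w : vertex X) :
  prefix (val v) (val w) -> prefix (val (g v)) (val (g w)).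
Proof.
case/prefixP=> t; case: w => s Hs /= es; move: Hs; rewrite {s}es.
elim/last_ind: t => [|t x IH] Hs.
  suff <- : v = Vertex Hs by exact: prefix_refl.
  by apply: val_inj; rewrite /= cats0.
have Hs' : is_string X (val v ++ t).
  by move: Hs; rewrite -rcons_cat is_string_rcons => /andP[].
have : child (Vertex Hs') (Vertex Hs) by exists x; rewrite /= rcons_cat.
move=> /(aut_child g)[y ->].
by apply: prefix_trans (IH Hs') _; exact: prefix_rcons.
Qed.

Lemma is_tree_autP X (f k : vertex X -> vertex X) :
  cancel f k -> cancel k f -> f (root_vertex X) = root_vertex X ->
  (forall u v, child u v -> child (f u) (f v)) ->
  (forall u v, child u v -> child (k u) (k v)) ->
  is_tree_aut f.
Proof.
move=> fk kf r cf ck; split=> //; first by exists k.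
by move=> u v; split=> [] [] => [/ck|/ck|/cf|/cf]; rewrite ?fk; [left|right|left|right].
Qed.

Section SectionAt.
Variables (X : nat -> {fset A}) (g : tree_aut X) (v : vertex X).
Local Notation Y := (shift_tree (vlen v) X).

Fact section_fun_subproof (w : vertex Y) :
  is_string Y (drop (vlen v) (val (g (vcat w)))).
Proof.
have /prefixP[t et] : prefix (val (g v)) (val (g (vcat w))).
  by apply: aut_prefix; apply/prefixP; exists (val w).
have ev : size (val (g v)) = vlen v by exact: aut_len.
have := valP (g (vcat w)); rewrite et is_string_cat => /andP[_].
by rewrite ev drop_size_cat.
Qed.

Definition section_fun (w : vertex Y) : vertex Y :=
  Vertex (section_fun_subproof w).

Lemma section_funE w : val (g (vcat w)) = val (g v) ++ val (section_fun w).
Proof.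
have /prefixP[t et] : prefix (val (g v)) (val (g (vcat w))).
  by apply: aut_prefix; apply/prefixP; exists (val w).
by rewrite /= et drop_size_cat // aut_size.
Qed.

Fact section_subproof : is_tree_aut section_fun.
Proof.
pose k (w : vertex Y) : seq A := val (g v) ++ val w.
have kP w : is_string X (k w).
  by rewrite /k is_string_cat (valP (g v)) aut_size (valP w).
pose ig := aut_inv g.
have igP w : val (ig (Vertex (kP w))) =
    val v ++ drop (vlen v) (val (ig (Vertex (kP w)))).
  have /prefixP[t et] : prefix (val v) (val (ig (Vertex (kP w)))).
    rewrite -[v in prefix (val v)](aut_invK g).
    by apply: aut_prefix; apply/prefixP; exists (val w).
  by rewrite et drop_size_cat.
have hP w : is_string Y (drop (vlen v) (val (ig (Vertex (kP w))))).
  by have := valP (ig (Vertex (kP w))); rewrite {1}igP is_string_cat => /andP[].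
pose h w : vertex Y := Vertex (hP w).
have fh : cancel section_fun h.
  move=> w; apply: val_inj => /=.
  have -> : Vertex (kP (section_fun w)) = g (vcat w).
    by apply: val_inj; rewrite section_funE.
  by rewrite aut_invK /= drop_size_cat.
have hf : cancel h section_fun.
  move=> w; apply: val_inj => /=.
  have -> : vcat (h w) = ig (Vertex (kP w)) by apply: val_inj; rewrite /= -igP.
  by rewrite aut_invKV /= /k drop_size_cat // aut_size.
have child_vcat (w w' : vertex Y) : child w w' -> child (vcat w) (vcat w').
  by move=> [x e]; exists x; rewrite /= e rcons_cat.
have child_cat (w w' : vertex Y) p (u u' : vertex X) :
    val u = p ++ val w -> val u' = p ++ val w' -> child u u' -> child w w'.
  move=> eu eu' [x]; rewrite eu eu' rcons_cat => /eqP.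
  by rewrite eqseq_cat // eqxx => /eqP e; exists x.
apply: (is_tree_autP fh hf).
- apply: val_inj => /=.
  have -> : vcat (root_vertex Y) = v by apply: val_inj; rewrite /= cats0.
  by rewrite drop_oversize // aut_size.
- move=> w w' /child_vcat/(aut_child g).
  by apply: child_cat; exact: section_funE.
- move=> w w' [x e].
  have : child (Vertex (kP w)) (Vertex (kP w')).
    by exists x; rewrite /= /k e rcons_cat.
  by move/(aut_child ig); apply: child_cat; exact: igP.
Qed.

Definition section_at : tree_aut Y := TreeAut section_subproof.

Lemma section_atE w : val (g (vcat w)) = val (g v) ++ val (section_at w).
Proof. exact: section_funE. Qed.

End SectionAt.

Section Insertion.
Variables (X : nat -> {fset A}) (v : vertex X).
Local Notation Y := (shift_tree (vlen v) X).
Implicit Types (h : tree_aut Y) (w : vertex Y) (u : vertex X).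

(* The default value of [insubd] is never used: removing the prefix [v] from a
   vertex of the original tree leaves a vertex of the shifted tree. *)
Definition ins_fun h u : vertex X :=
  if prefix (val v) (val u)
  then vcat (h (insubd (root_vertex Y) (drop (vlen v) (val u)))) else u.

Lemma ins_fun_vcat h w : ins_fun h (vcat w) = vcat (h w).
Proof. by rewrite /ins_fun prefix_prefix /= drop_size_cat // valKd. Qed.

Lemma ins_fun_out h u : ~~ prefix (val v) (val u) -> ins_fun h u = u.
Proof. by rewrite /ins_fun => /negPf->. Qed.

Lemma prefix_vcat u : prefix (val v) (val u) -> exists w, u = vcat w.
Proof.
case/prefixP=> t et; have := valP u; rewrite et is_string_cat => /andP[_ tP].
by exists (Vertex tP); exact: val_inj.
Qed.

Lemma ins_fun_child h u u' : child u u' -> child (ins_fun h u) (ins_fun h u').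
Proof.
case: (boolP (prefix (val v) (val u))) => [/prefix_vcat[w ->]|pu] [x e].
  have /prefix_vcat[w' ew'] : prefix (val v) (val u').
    by rewrite e /= rcons_cat prefix_prefix.
  rewrite ew' !ins_fun_vcat.
  have : child w w'.
    exists x; move/eqP: e; rewrite ew' /= rcons_cat eqseq_cat // eqxx.
    by move/eqP.
  by move/(aut_child h)=> [y ey]; exists y; rewrite /= ey rcons_cat.
rewrite (ins_fun_out h pu).
case: (boolP (prefix (val v) (val u'))) => [|pu']; last first.
  by rewrite ins_fun_out //; exists x.
rewrite e => /prefixP[t].
case/lastP: t => [|t y] et; last first.
  move/eqP: et; rewrite -rcons_cat eqseq_rcons => /andP[/eqP eu _].
  by rewrite eu prefix_prefix in pu.
suff -> : u' = vcat (root_vertex Y).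
  rewrite ins_fun_vcat; have [_ -> _] := aut_funP h.
  by exists x; rewrite et.
by apply: val_inj; rewrite e et.
Qed.

Fact ins_subproof h : is_tree_aut (ins_fun h).
Proof.
have K (k k' : tree_aut Y) : cancel k k' -> cancel (ins_fun k) (ins_fun k').
  move=> kk u; case: (boolP (prefix (val v) (val u))) => [/prefix_vcat[w ->]|pu].
    by rewrite !ins_fun_vcat kk.
  by rewrite !ins_fun_out // ins_fun_out.
apply: (@is_tree_autP _ _ (ins_fun (aut_inv h))).
- exact/K/aut_invK.
- exact/K/aut_invKV.
- case: (boolP (prefix (val v) (val (root_vertex X)))) => [|/ins_fun_out//].
  move=> /prefix_vcat[w ew]; rewrite [in LHS]ew ins_fun_vcat.
  have ev : val v ++ val w = [::] by rewrite -[LHS]/(val (vcat w)) -ew.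
  have ew0 : w = root_vertex Y by apply: val_inj; case: (val v) ev.
  by have [_ hr _] := aut_funP h; rewrite ew0 hr ew ew0.
- exact: ins_fun_child.
- exact: ins_fun_child.
Qed.

Definition ins h : tree_aut X := TreeAut (ins_subproof h).

End Insertion.

Definition rist X (Gamma : set (tree_aut X)) (v : vertex X) : set (tree_aut X) :=
  [set g | [/\ Gamma g, forall u, layer X (vlen v) u -> g u = u &
               forall u, layer X (vlen v) u -> u <> v -> section_at g u = 1]].

Lemma vcat_root X (v : vertex X) : vcat (root_vertex (shift_tree (vlen v) X)) = v.
Proof. by apply: val_inj; rewrite /= cats0. Qed.

Lemma vcat_inj X (v : vertex X) : injective (@vcat X v).
Proof.
move=> w w' /(congr1 val)/eqP; rewrite eqseq_cat // eqxx => /eqP e.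
exact: val_inj.
Qed.

Lemma prefix_layer X (v u : vertex X) :
  layer X (vlen v) u -> prefix (val v) (val u) -> u = v.
Proof.
move=> eu /prefixP[t et]; apply: val_inj.
have : size (val u) = size (val v) by exact: eu.
by rewrite et size_cat -[RHS]addn0 => /addnI/size0nil->; rewrite cats0.
Qed.

Lemma section_ins X (v : vertex X) (h : tree_aut (shift_tree (vlen v) X)) :
  section_at (ins h) v = h.
Proof.
apply: aut_ext => w; apply: val_inj; rewrite /= ins_fun_vcat /=.
by rewrite drop_size_cat.
Qed.

Lemma ins_rist X (v : vertex X) (h : tree_aut (shift_tree (vlen v) X)) :
  rist setT v (ins h).
Proof.
have insu u : layer X (vlen v) u -> u <> v -> forall w : vertex (shift_tree (vlen u) X),
    ins h (vcat w) = vcat w.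
  move=> lu uv w; apply: ins_fun_out; apply/negP => p; apply: uv.
  apply: (prefix_layer lu); move: p => /prefixP[t] /= /eqP.
  rewrite eqseq_cat; last exact: lu.
  by case/andP=> /eqP-> _; exact: prefix_refl.
split=> // u lu; last first.
  move=> uv; apply: aut_ext => w; apply: val_inj => /=.
  by rewrite -[ins_fun h _]/(ins h _) insu //= drop_size_cat.
case: (pselect (u = v)) => [->|uv]; last first.
  by rewrite -[in LHS](vcat_root u) insu // vcat_root.
have [_ hr _] := aut_funP h.
transitivity (ins h (vcat (root_vertex (shift_tree (vlen v) X)))); first by rewrite vcat_root.
by rewrite /= ins_fun_vcat hr vcat_root.
Qed.

Lemma vertex_split X n (u : vertex X) : n <= vlen u ->
  exists (v : vertex X) (w : vertex (shift_tree (vlen v) X)),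
    vlen v = n /\ u = vcat w.
Proof.
move=> nu; have := valP u.
rewrite -(cat_take_drop n (val u)) is_string_cat => /andP[tP dP].
exists (Vertex tP), (Vertex dP); split; first exact: size_takel.
by apply: val_inj; rewrite /= cat_take_drop.
Qed.

Lemma ins_uniq X (v : vertex X) (h : tree_aut (shift_tree (vlen v) X)) (k : tree_aut X) :
  rist setT v k -> section_at k v = h -> k = ins h.
Proof.
move=> [_ kfix kid] <-; apply: aut_ext => u.
case: (leqP (vlen v) (vlen u)) => [vu|uv].
  have [u1 [w [lu1 ->]]] := vertex_split vu.
  case: (pselect (u1 = v)) => [e|nuv].
    subst u1; apply: val_inj.
    by rewrite /= ins_fun_vcat section_atE kfix.
  have nu : ~~ prefix (val v) (val (vcat w)).
    apply/negP => /prefixP[t] /eqP; rewrite eqseq_cat => [/andP[/eqP e _]|].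
      by apply: nuv; exact: val_inj.
    exact: lu1.
  apply: val_inj; rewrite /= ins_fun_out //.
  by rewrite section_atE kfix // kid.
have nu : ~~ prefix (val v) (val u).
  by apply/negP => /size_prefix; rewrite leqNgt uv.
rewrite /= ins_fun_out //.
have [p [w [lp ev]]] := vertex_split (ltnW uv).
have eqX : vlen u = vlen p by rewrite lp.
have tP : is_string X (val u ++ val w).
  by rewrite is_string_cat (valP u) -/(vlen u); move: (valP w); rewrite eqX.
have lt : layer X (vlen v) (Vertex tP).
  rewrite /layer /= ev /vlen /= !size_cat; congr (_ + _)%N; exact: eqX.
have : prefix (val (k u)) (val (k (Vertex tP))).
  by apply: aut_prefix; exact: prefix_prefix.
rewrite (kfix _ lt) => /prefixP[t] /= /eqP.
by rewrite eqseq_cat ?aut_size // => /andP[/eqP e _]; exact: val_inj.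
Qed.

Section BranchGroups.
Variables (X : nat -> {fset A}) (Gamma : set (tree_aut X)).

Definition spherically_transitive : Prop :=
  forall n u v, layer X n u -> layer X n v -> exists2 g, Gamma g & g u = v.

Definition Rist n : set (tree_aut X) :=
  subgroup_generated (\bigcup_(v in layer X n) rist Gamma v).

Definition branch_group : Prop :=
  [/\ is_subgroup Gamma, spherically_transitive &
      forall n, finite_index Gamma (Rist n)].

Definition layered : Prop :=
  forall g (v : vertex X), Gamma g -> Gamma (ins (section_at g v)).

Definition layered_branch_group : Prop := branch_group /\ layered.

End BranchGroups.
End Trees.

(* Main.v *)
From HB Require Import structures.
Require Import Defs.
From mathcomp Require Import all_boot fingroup finmap.
From mathcomp Require Import morphism gseries commutator nilpotent alt.
From mathcomp Require Import boolp classical_sets functions cardinality.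

(** Discard the trivial factors of the residual representation and repeat each
remaining one infinitely often, giving surjections [rho n : G -> S n].  The
tree has [S n] as alphabet of level [n], acted on by right multiplication
("rooted" automorphisms).  An element [g] of [G] acts on the tree at level [n]
as a "directed" automorphism: it fixes the first layer, its section at the
letter [1] is again directed by [g], its sections at two further letters [a]
and [a * b] are rooted by [rho n.+1 g], and the others are trivial.  For
[M <= G] let [Gamma_n(M)] be generated by the rooted automorphisms and those
directed by [M].  If all [rho m] are onto on [M], commutators of directed
automorphisms isolate the commutators of [S n.+1] at the single letter [a * b];
as [S n.+1] is perfect, [Gamma_n(M)] is the permutational wreath product of
[Gamma_(n+1)(M)] and [S n], so that [Gamma_0(G)] is layered and branch.

Let [M] be a nonnormal maximal subgroup, so that [M] and [M ^ g] generate [G]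
for every [g] outside [M].  If all [rho n] are onto on [M], then [M] is lifted
to [Gamma_0(M)].  Otherwise some [rho k] is not, and [M] is lifted to the
elements of [Gamma_0(G)] whose sections at level [k] act on letters through
[rho k M].  In both cases [Gamma_0(G)] is generated by the lift and any
conjugate of it by an element outside it: this passes from a section of that
element to the element itself, and taking sections reduces the number of
directed factors, until only one is left.  If [G] is trivial, the construction
is applied to the alternating group of degree 5. *)

Set Implicit Arguments.
Unset Strict Implicit.
Unset Printing Implicit Defensive.

Local Open Scope classical_set_scope.
Local Open Scope group_scope.

(** * Groups and abnormality *)

Section GroupMorphisms.
Variables (M N : groupType) (f : N -> M).
Hypothesis fM : {morph f : x y / x * y}.

Lemma group_morph1 : f 1 = 1.
Proof. by apply: (mulgI (f 1)); rewrite -fM !mulg1. Qed.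

Lemma group_morphV x : f x^-1 = (f x)^-1.
Proof. by apply: (mulgI (f x)); rewrite -fM !mulgV group_morph1. Qed.

Lemma group_morphJ x y : f (x ^ y) = f x ^ f y.
Proof. by rewrite !conjgE !fM group_morphV. Qed.

Lemma morph_is_subgroup (H : set M) : is_subgroup H -> is_subgroup (f @^-1` H).
Proof.
move=> [H1 HM HV]; split=> [|x y Hx Hy|x Hx]; rewrite /preimage /=.
- by rewrite group_morph1.
- by rewrite fM; exact: HM.
- by rewrite group_morphV; exact: HV.
Qed.

End GroupMorphisms.

Section SubgroupLemmas.
Variable M : groupType.
Implicit Types (H K L D E : set M) (x y g : M).

Lemma subgroupJ H x y : is_subgroup H -> H x -> H y -> H (x ^ y).
Proof. by move=> [_ HM HV] Hx Hy; apply: (HM); [exact: HV|exact: HM]. Qed.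

Lemma is_subgroupT : is_subgroup [set: M].
Proof. by []. Qed.

Lemma is_subgroup_generated E : is_subgroup (subgroup_generated E).
Proof.
split=> [H [] //|x y Ex Ey H HP EH|x Ex H HP EH].
- by have [_ HM _] := HP; apply: HM; [exact: Ex|exact: Ey].
- by have [_ _ HV] := HP; apply: HV; exact: Ex.
Qed.

Lemma sub_generated E : E `<=` subgroup_generated E.
Proof. by move=> x Ex H _; exact. Qed.

Lemma generated_sub E H : is_subgroup H -> E `<=` H -> subgroup_generated E `<=` H.
Proof. by move=> HP EH x; exact. Qed.

(* For a subgroup [D] of [K], this says that [D] and [D ^ g] generate a subgroup
   containing [K]; unlike maximality, it can be checked on a section of [g]. *)
Definition abnormal K D g :=
  forall L, is_subgroup L -> D `<=` L -> (forall x, D x -> L (x ^ g)) -> K `<=` L.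

Lemma abnormal_maximal K D : is_subgroup D -> D `<` K ->
  (forall g, K g -> ~ D g -> abnormal K D g) -> maximal_subgroup K D.
Proof.
move=> DP DK abn; split=> // L LP DL LK.
have [LD|] := pselect (L `<=` D); first by left; apply/seteqP.
move/existsNP=> [g /not_implyP[Lg Dg]]; right; apply/seteqP; split=> //.
apply: (abn g) => //; first exact: LK.
by move=> x Dx; apply: subgroupJ => //; exact: DL.
Qed.

(** A subgroup containing [D] and [D ^ g] is [D] or everything. If it is [D], maximality gives
    [D ^ g = D], so the normaliser of [D] is larger than [D], hence everything, against
    nonnormality. *)
Lemma nonnormal_maximal_abnormal D g :
  maximal_subgroup [set: M] D -> ~ normal_in [set: M] D -> ~ D g ->
  abnormal [set: M] D g.
Proof.
move=> [DP [_ DT] maxD] nD Dg L LP DL DgL.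
have [LD|->//] := maxD _ LP DL (subsetT _); case: nD; split=> // x y Dx _.
move: DgL; rewrite LD => DgD {L LP DL LD}.
(* [J h] is the conjugate of [D] by [h^-1]; [N] below is the normaliser of [D]. *)
pose J (h : M) := [set x | D (x ^ h)].
have JP h : is_subgroup (J h).
  by apply: morph_is_subgroup (DP) => u v; rewrite conjMg.
have JD : J g = D.
  have [//|JT] := maxD _ (JP g) DgD (subsetT _); case: (DT) => z _.
  have : J g (z ^ g^-1) by rewrite JT.
  by rewrite /J /= conjgKV.
pose N := [set h | J h = D].
have NP : is_subgroup N.
  split; rewrite /N /=.
  - by apply/seteqP; split=> z; rewrite /J /= conjg1.
  - move=> h k Jh Jk; apply/seteqP; split=> z.
      rewrite /J /= conjgM => Dz; have : J k (z ^ h) by [].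
      by rewrite Jk => Dzh; rewrite -Jh.
    rewrite -{1}Jh => Jz; rewrite /J /= conjgM.
    by have : D (z ^ h) by []; rewrite -{1}Jk.
  - move=> h Jh; apply/seteqP; split=> z.
      by rewrite /J /= -{1}Jh /J /= conjgKV.
    by move=> Dz; rewrite /J /= -Jh /J /= conjgKV.
have DN : D `<=` N.
  have DD u z : D u -> D z -> D (z ^ u) by move=> Du Dz; exact: subgroupJ.
  move=> u Du; apply/seteqP; split=> z; rewrite /J /=; last exact: DD.
  by have [_ _ DV] := DP; move/(DD _ _ (DV _ Du)); rewrite conjgK.
have [ND|NT] := maxD _ NP DN (subsetT _).
  by case: Dg; rewrite -ND.
have : N y by rewrite NT.
by rewrite /N /= => Jy; rewrite -Jy in Dx.
Qed.

(** Together with [abnormal_mull], this lets factors in [D] be dropped on both sides. *)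
Lemma abnormal_mulr K D x y : is_subgroup D -> D y ->
  abnormal K D x -> abnormal K D (x * y).
Proof.
move=> DP Dy abn L LP DL xyL; apply: abn => // z Dz.
have [_ _ LV] := LP.
rewrite -[z ^ x](conjgK y) -(conjgM z).
by apply: (subgroupJ LP); [exact: xyL|apply: LV; exact: DL].
Qed.

Lemma abnormal_mull K D x y : is_subgroup D -> D y ->
  abnormal K D x -> abnormal K D (y * x).
Proof.
move=> DP Dy abn L LP DL yxL; apply: abn => // z Dz.
have [_ _ DV] := DP.
rewrite -[z](conjgKV y) -(conjgM _ y).
by apply: yxL; apply: (subgroupJ DP) => //; exact: DV.
Qed.

End SubgroupLemmas.

Lemma perfect_subgroup (T : finGroupType) (P : set T) :
  perfect_group T -> is_subgroup P -> (forall x y, P [~ x, y]) -> forall x, P x.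
Proof.
move=> perfT [P1 PM PV] PR x.
pose K := finset (fun x => `[< P x >]).
have KE u : (u \in K) = `[< P u >] by rewrite inE.
have KP : group_set K.
  apply/group_setP; split=> [|u v]; rewrite !KE; first exact: asboolT.
  by move=> /asboolP Pu /asboolP Pv; apply: asboolT; exact: PM.
suff : x \in K by rewrite KE => /asboolP.
have : x \in [~: [set: T]%G, [set: T]%G]%g by rewrite perfT finset.in_setT.
apply: fintype.subsetP; rewrite -[K]/(gval (Group KP)) gen_subG.
by apply/fintype.subsetP => _ /imset2P[u v _ _ ->]; rewrite KE; exact: asboolT.
Qed.

(** * Layered spherically transitive groups are branch groups *)

Section BranchFromLayered.
Variables (A : choiceType) (X : nat -> {fset A}) (Gamma : set (tree_aut X)).
Hypotheses (GP : is_subgroup Gamma) (Gl : layered Gamma).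

Lemma layer_finite n :
  exists l : seq (vertex X), forall v, @layer A X n v -> v \in l.
Proof.
elim: n => [|n [l Hl]].
  exists [:: root_vertex X] => v /size0nil v0; rewrite inE.
  by apply/eqP; exact: val_inj.
pose ext (u : vertex X) : seq (vertex X) :=
  pmap insub [seq rcons (val u) x | x <- enum_fset (X n)].
exists (flatten [seq ext u | u <- l]) => v vn.
have [u [x e] un] := parent_ex vn.
apply/flattenP; exists (ext u); first by apply: map_f; exact: Hl.
rewrite mem_pmap; apply/mapP; exists (val v); last by rewrite valK.
rewrite e map_f //; have := valP v; rewrite e is_string_rcons => /andP[_].
by rewrite -/(vlen u) un.
Qed.

Lemma ball_finite n : exists l : seq (vertex X), forall v, vlen v <= n -> v \in l.
Proof.
elim: n => [|n [l Hl]].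
  by have [l Hl] := layer_finite 0; exists l => v; rewrite leqn0 => /eqP; exact: Hl.
have [l' Hl'] := layer_finite n.+1; exists (l ++ l') => v.
rewrite mem_cat leq_eqVlt => /orP[/eqP /Hl' ->|]; first by rewrite orbT.
by rewrite ltnS => /Hl ->.
Qed.

Lemma ins_sectionE (g : tree_aut X) v u : val (ins (section_at g v) u) =
  if prefix (val v) (val u) then val v ++ drop (vlen v) (val (g u)) else val u.
Proof.
case: ifPn => [pvu|]; last by move=> /ins_fun_out e; rewrite [ins _ u]e.
have [w ->] := prefix_vcat pvu.
by rewrite [ins _ _](ins_fun_vcat (section_at g v) w).
Qed.

Lemma ins_section_fix (g : tree_aut X) v u : g v = v ->
  ins (section_at g v) u = if prefix (val v) (val u) then g u else u.
Proof.
move=> gv; apply: val_inj; rewrite ins_sectionE; case: ifPn => // pvu.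
have /prefixP[t e] : prefix (val v) (val (g u)) by rewrite -{1}gv; exact: aut_prefix.
by rewrite e drop_size_cat.
Qed.

(** Such a [g] is the product of the insertions of its sections at layer [n], which lie in the rigid
    stabilisers by layeredness. *)
Lemma Rist_ball_stab n g : Gamma g -> (forall u, vlen u <= n -> g u = u) ->
  Rist Gamma n g.
Proof.
move=> Gg gfix.
have [R1 RM _] := is_subgroup_generated (\bigcup_(v in @layer A X n) rist Gamma v).
have H (l : seq (vertex X)) : uniq l -> (forall v, v \in l -> vlen v = n) ->
    exists2 h, Rist Gamma n h &
      forall u, h u = if take n (val u) \in map val l then g u else u.
  elim: l => [|v l IHl] /=; first by move=> _ _; exists 1.
  case/andP=> vl ul vln.
  have [|h Rh hE] := IHl ul.
    by move=> u ul'; apply: vln; rewrite in_cons ul' orbT.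
  have vn : vlen v = n by apply: vln; exact: mem_head.
  have gv : g v = v by apply: gfix; rewrite vn.
  exists (ins (section_at g v) * h).
    apply: RM => //; apply: sub_generated; exists v => //.
    have [_ i1 i2] := ins_rist (section_at g v); split=> //; exact: Gl.
  move=> u; rewrite -[LHS]/(h (ins (section_at g v) u)) ins_section_fix //.
  rewrite in_cons prefixE -/(vlen v) vn.
  case: eqP => [uv|_] /=; last exact: hE.
  rewrite hE; suff -> : take n (val (g u)) = val v.
    by rewrite mem_map ?(negPf vl) //; exact: val_inj.
  have : prefix (val (g v)) (val (g u)).
    by apply: aut_prefix; rewrite prefixE -/(vlen v) vn uv.
  by rewrite gv prefixE -/(vlen v) vn => /eqP.
have [l Hl] := layer_finite n.
have [||h Rh hE] := H (undup [seq v <- l | vlen v == n]).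
- exact: undup_uniq.
- by move=> v; rewrite mem_undup mem_filter => /andP[/eqP].
suff -> : g = h by [].
apply: aut_ext => u; rewrite hE; case: ifPn => // nu.
have [un|/ltnW/gfix//] := leqP n (vlen u).
have [v [w [vn e]]] := vertex_split un.
case/negP: nu; apply/mapP; exists v.
  by rewrite mem_undup mem_filter vn eqxx Hl.
by rewrite e /= -vn take_size_cat.
Qed.

Lemma Rist_finite_index n : finite_index Gamma (Rist Gamma n).
Proof.
split.
  by apply: generated_sub => // g [v _ []].
have [l Hl] := ball_finite n.
(* [phi k] determines the coset of [k]. The default of [insubd] can occur only at members of [l]
   outside the ball, as [k] preserves length. *)
pose phi (k : tree_aut X) : {ffun seq_sub l -> seq_sub l} :=
  [ffun x => insubd x (k (val x))].
pose coset k := [set h * k | h in Rist Gamma n].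
pose F f := xget set0 [set c | exists k, [/\ Gamma k, phi k = f & c = coset k]].
apply: (@sub_finite_set _ _ (range F)); last first.
  by apply: finite_image; exact: finite_finset.
move=> _ [k Gk <-]; exists (phi k) => //.
have : [set c | exists k', [/\ Gamma k', phi k' = phi k & c = coset k']] (F (phi k)).
  by apply: xgetPex; exists (coset k), k.
move=> [k' [Gk' phik ->]].
have [G1 GM GV] := GP.
have kk' u : vlen u <= n -> k' u = k u.
  move=> un; have ul := Hl _ un.
  have : val (phi k' (SeqSub ul)) = val (phi k (SeqSub ul)) by rewrite phik.
  by rewrite !ffunE !val_insubd /= !Hl // -[vlen _]/(vlen _) aut_len.
have kRist h h' : Gamma h -> Gamma h' -> (forall u, vlen u <= n -> h u = h' u) ->
    Rist Gamma n (h * h'^-1).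
  move=> Gh Gh' hh'; apply: Rist_ball_stab; first by apply: GM => //; exact: GV.
  by move=> u un; rewrite -[LHS]/(aut_inv h' (h u)) hh' // aut_invK.
have [_ RM _] := is_subgroup_generated (\bigcup_(v in @layer A X n) rist Gamma v).
apply/seteqP; split=> _ [h Rh <-].
- exists (h * (k' * k^-1)); first by apply: RM => //; exact: kRist.
  by rewrite -!mulgA mulVg mulg1.
- exists (h * (k * k'^-1)); first by apply: RM => //; apply: kRist => // u /kk'.
  by rewrite -!mulgA mulVg mulg1.
Qed.

Lemma layered_branch : spherically_transitive Gamma -> layered_branch_group Gamma.
Proof. by move=> Gt; split=> //; split=> //; exact: Rist_finite_index. Qed.

End BranchFromLayered.

(** * The tree of a sequence of finite groups *)

Section Alphabet.
Variable T : finGroupType.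

(** All letters of a tree come from one type, so group elements are coded by their position in
    [enum]. *)
Definition alphabet : {fset nat} := [fset i in iota 0 #|T|]%fset.
Definition encode (t : T) : nat := index t (enum T).
Definition decode (i : nat) : T := nth 1 (enum T) i.

Lemma mem_alphabet i : (i \in alphabet) = (i < #|T|).
Proof. by rewrite !inE mem_iota. Qed.

Lemma encodeK : cancel encode decode.
Proof. by move=> t; rewrite /decode nth_index ?mem_enum. Qed.

Lemma encode_alphabet t : encode t \in alphabet.
Proof. by rewrite mem_alphabet cardE index_mem mem_enum. Qed.

Lemma decodeK i : i \in alphabet -> encode (decode i) = i.
Proof. by rewrite mem_alphabet cardE => ?; exact: index_uniq (enum_uniq _). Qed.

Lemma card_alphabet : #|` alphabet| = #|T|.
Proof. by rewrite card_fseq undup_id ?iota_uniq // size_iota. Qed.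

End Alphabet.

Section RegularTree.
Variable S : nat -> finGroupType.

(* With the tail-recursive addition, [shift_tree 1 (letters n)] is convertible
   to [letters n.+1], so that sections need no transport between trees. *)
Definition letters n : nat -> {fset nat} :=
  fun m => alphabet (S (NatTrec.add m n)).

Local Notation W n := (tree_aut (letters n)).

Fact vcons_subproof n (t : S n) (w : vertex (letters n.+1)) :
  is_string (letters n) (encode t :: val w).
Proof. by rewrite /= encode_alphabet; exact: valP w. Qed.

Definition vcons n (t : S n) (w : vertex (letters n.+1)) : vertex (letters n) :=
  Vertex (vcons_subproof t w).

Definition vletter n (t : S n) : vertex (letters n) := vcons t (root_vertex _).

Lemma vconsP n (v : vertex (letters n)) :
  v = root_vertex _ \/ exists t w, v = vcons t w.
Proof.
case: v => -[|i s] Hs; [left|right]; first exact: val_inj.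
have /andP[Hi Hs'] := Hs.
exists (decode (S n) i), (@Vertex nat (letters n.+1) s Hs').
by apply: val_inj; rewrite /= decodeK.
Qed.

Lemma vcons_inj n (t u : S n) v w : vcons t v = vcons u w -> t = u /\ v = w.
Proof.
move=> /(congr1 val)[/(can_inj (@encodeK _)) -> e]; split=> //.
exact: val_inj.
Qed.

Definition act n (g : W n) (t : S n) : S n :=
  decode (S n) (head 0 (val (g (vletter t)))).

Definition sec n (g : W n) (t : S n) : W n.+1 :=
  @section_at nat (letters n) g (vletter t).

Lemma aut_vcons n (g : W n) t w : g (vcons t w) = vcons (act g t) (sec g t w).
Proof.
have := @section_atE nat (letters n) g (vletter t) w.
have -> : vcat (v := vletter t) w = vcons t w by exact: val_inj.
move=> e; apply: val_inj; rewrite e.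
rewrite -[RHS]/([:: encode (act g t)] ++ val (section_at g (vletter t) w)).
congr cat; rewrite /act.
have := aut_size g (vletter t); have := valP (g (vletter t)).
by case: (val (g (vletter t))) => [|i [|j s]] //= /andP[Hi _] _; rewrite decodeK.
Qed.

Lemma act_sec_eq n (g : W n) t u k :
  (forall w, g (vcons t w) = vcons u (aut_fun k w)) -> act g t = u /\ sec g t = k.
Proof.
move=> H; split.
  by have := H (root_vertex _); rewrite aut_vcons => /vcons_inj[].
by apply: aut_ext => w; have := H w; rewrite aut_vcons => /vcons_inj[].
Qed.

Lemma aut_root n (g : W n) : g (root_vertex _) = root_vertex _.
Proof. by have [_ ->] := aut_funP g. Qed.

(** A coinduction principle: for self-similar automorphisms an identity reappears among its own
    sections. *)
Lemma aut_bisim (R : forall n, W n -> W n -> Prop) :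
  (forall n g h, R n g h ->
     forall t, act g t = act h t /\ R n.+1 (sec g t) (sec h t)) ->
  forall n g h, R n g h -> g = h.
Proof.
move=> HR n g h Rgh; apply: aut_ext => v.
have [s] := ex_intro (fun s => val v = s) _ erefl.
elim: s n g h v Rgh => [|i s IHs] n g h v Rgh es.
  by have -> : v = root_vertex _; [exact: val_inj|rewrite !aut_root].
have [e|[t [w e]]] := vconsP v; first by rewrite e in es.
have [gh Rsec] := HR _ _ _ Rgh t.
rewrite e !aut_vcons gh; congr vcons; apply: IHs Rsec _.
by move: es; rewrite e /= => -[].
Qed.

Lemma aut_act_sec_ext n (g h : W n) : act g =1 act h -> sec g =1 sec h -> g = h.
Proof.
move=> gh1 gh2; apply: aut_ext => v.
have [->|[t [w ->]]] := vconsP v; first by rewrite !aut_root.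
by rewrite !aut_vcons gh1 gh2.
Qed.

Lemma act1 n (t : S n) : act (1 : W n) t = t.
Proof. by have [] := @act_sec_eq n 1 t t 1. Qed.

Lemma sec1 n (t : S n) : sec (1 : W n) t = 1.
Proof. by have [] := @act_sec_eq n 1 t t 1. Qed.

Lemma act_secM n (g h : W n) t :
  act (g * h) t = act h (act g t) /\ sec (g * h) t = sec g t * sec h (act g t).
Proof.
apply: act_sec_eq => w.
by rewrite -[(g * h) (vcons t w)]/(h (g (vcons t w))) !aut_vcons.
Qed.

Lemma actM n (g h : W n) t : act (g * h) t = act h (act g t).
Proof. by have [] := act_secM g h t. Qed.

Lemma secM n (g h : W n) t : sec (g * h) t = sec g t * sec h (act g t).
Proof. by have [] := act_secM g h t. Qed.

Definition ins1 n (t : S n) (h : W n.+1) : W n :=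
  @ins nat (letters n) (vletter t) h.

Lemma ins1_vcons n (t u : S n) h w :
  ins1 t h (vcons u w) = vcons u (if u == t then h w else w).
Proof.
case: eqP => [->|ut].
  have -> : vcons t w = @vcat nat (letters n) (vletter t) w by exact: val_inj.
  rewrite [LHS](@ins_fun_vcat nat (letters n) (vletter t) h w).
  exact: val_inj.
apply: ins_fun_out; apply/negP => /= /andP[/eqP/(can_inj (@encodeK _)) e _].
by case: ut.
Qed.

Lemma act_ins n (t u : S n) h : act (ins1 t h) u = u.
Proof.
have [] // := @act_sec_eq n (ins1 t h) u u (if u == t then h else 1).
by move=> w; rewrite ins1_vcons; case: eqP.
Qed.

Lemma sec_ins n (t u : S n) h : sec (ins1 t h) u = if u == t then h else 1.
Proof.
have [] // := @act_sec_eq n (ins1 t h) u u (if u == t then h else 1).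
by move=> w; rewrite ins1_vcons; case: eqP.
Qed.

End RegularTree.

(** * Rooted and directed automorphisms *)

Section DirectedAutomorphisms.
Variables (G : groupType) (S : nat -> finGroupType).
Variable rho : forall n, G -> S n.
Variables a b : forall n, S n.
Hypothesis rhoM : forall n, {morph @rho n : x y / x * y}.
Hypothesis rho_surj : forall n s, exists g, @rho n g = s.
Hypothesis rho_faithful : forall n g, (forall m, n <= m -> @rho m g = 1) -> g = 1.
Hypothesis S_perfect : forall n, perfect_group (S n).
(* They make the letters [1, a, a * b] distinct and let this set meet its right
   translate by [b] only in [a * b]. *)
Hypothesis a_notin : forall n, a n \notin <[b n]>.
Hypothesis b_sqr : forall n, b n * b n != 1.

Local Notation W n := (tree_aut (letters S n)).

(** States of an automaton reading strings letter by letter; this replaces a corecursive definition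
    of directed automorphisms. *)
Inductive state n := Directed of G | Rooted of S n.
Arguments Directed {n} g.

Definition state_act n (q : state n) (t : S n) : S n :=
  if q is Rooted s then t * s else t.

Definition state_sec n (q : state n) (t : S n) : state n.+1 :=
  match q with
  | Directed g =>
    if t == 1 then Directed g
    else if (t == a n) || (t == a n * b n) then Rooted (rho n.+1 g)
    else Rooted 1
  | Rooted _ => Rooted 1
  end.

Definition state_inv n (q : state n) : state n :=
  match q with Directed g => Directed g^-1 | Rooted s => Rooted s^-1 end.

Lemma state_act_inv n (q : state n) t : state_act (state_inv q) (state_act q t) = t.
Proof. by case: q => //= s; rewrite mulgK. Qed.

Lemma state_sec_inv n (q : state n) t :
  state_sec (state_inv q) (state_act q t) = state_inv (state_sec q t).
Proof.
case: q => [g|s] /=; last by rewrite invg1.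
case: ifP => // _; case: ifP => _ /=; last by rewrite invg1.
by rewrite (group_morphV (@rhoM n.+1)).
Qed.

Lemma state_invK n : involutive (@state_inv n).
Proof. by case=> x /=; rewrite invgK. Qed.

Fixpoint run n (q : state n) (s : seq nat) : seq nat :=
  if s is i :: s'
  then let t := decode (S n) i in
    encode (state_act q t) :: run (state_sec q t) s'
  else [::].

Lemma run_string n (q : state n) s : is_string (letters S n) (run q s).
Proof.
elim: s n q => [//|i s IHs] n q /=.
by rewrite encode_alphabet; exact: IHs.
Qed.

Lemma runK n (q : state n) s :
  is_string (letters S n) s -> run (state_inv q) (run q s) = s.
Proof.
elim: s n q => [//|i s IHs] n q /= /andP[Hi Hs].
rewrite encodeK state_act_inv decodeK // state_sec_inv; congr cons.
exact: IHs.
Qed.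

Lemma run_rcons n (q : state n) s i :
  exists j, run q (rcons s i) = rcons (run q s) j.
Proof.
elim: s n q => [|k s IHs] n q /=.
  by exists (encode (state_act q (decode (S n) i))).
by have [j ->] := IHs _ (state_sec q (decode (S n) k)); exists j.
Qed.

Definition run_vertex n (q : state n) (v : vertex (letters S n)) :
  vertex (letters S n) := Vertex (run_string q (val v)).

Fact run_subproof n (q : state n) : is_tree_aut (run_vertex q).
Proof.
have child_run p u v : child u v -> child (@run_vertex n p u) (run_vertex p v).
  by move=> [i e]; have [j ej] := run_rcons p (val u) i; exists j; rewrite /= e.
apply: (is_tree_autP (k := run_vertex (state_inv q))) => //.
- by move=> v; apply: val_inj; rewrite /= runK // (valP v).
- move=> v; apply: val_inj; rewrite /= -{1}[q]state_invK runK // (valP v) //.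
- exact: val_inj.
- exact: child_run.
- exact: child_run.
Qed.

Definition run_aut n (q : state n) : W n := TreeAut (run_subproof q).

Lemma act_sec_run n (q : state n) t :
  act (run_aut q) t = state_act q t /\ sec (run_aut q) t = run_aut (state_sec q t).
Proof.
apply: act_sec_eq => w; apply: val_inj.
by rewrite /= encodeK.
Qed.

Definition rooted n (s : S n) : W n := run_aut (Rooted s).
Definition directed n (g : G) : W n := run_aut (Directed g).

Lemma rooted1 n : rooted (1 : S n) = 1.
Proof.
apply: (aut_bisim (R := fun n g h => g = rooted 1 /\ h = 1)) => // m g h [-> ->] t.
have [-> ->] := act_sec_run (Rooted (1 : S m)) t.
by rewrite act1 sec1 /= mulg1.
Qed.

Lemma act_rooted n (s t : S n) : act (rooted s) t = t * s.
Proof. by have [-> _] := act_sec_run (Rooted s) t. Qed.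

Lemma sec_rooted n (s t : S n) : sec (rooted s) t = 1.
Proof. by have [_ ->] := act_sec_run (Rooted s) t; exact: rooted1. Qed.

Lemma act_directed n g t : act (directed n g) t = t.
Proof. by have [-> _] := act_sec_run (Directed g) t. Qed.

Lemma sec_directed n g t : sec (directed n g) t =
  if t == 1 then directed n.+1 g
  else if (t == a n) || (t == a n * b n) then rooted (rho n.+1 g) else 1.
Proof.
have [_ ->] := act_sec_run (Directed g) t; rewrite -rooted1 /=.
by do 2?case: ifP.
Qed.

Lemma rootedM n : {morph @rooted n : s t / s * t}.
Proof.
move=> s t; apply: aut_act_sec_ext => u.
  by rewrite actM !act_rooted mulgA.
by rewrite secM !sec_rooted mulg1.
Qed.

Lemma directedM n : {morph directed n : g h / g * h}.
Proof.
(* The claim recurs at the letter [1]; at the other letters the sections are equal outright. *)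
move=> g h; pose R m (x y : W m) :=
  x = y \/ x = directed m (g * h) /\ y = directed m g * directed m h.
apply: (aut_bisim (R := R)); last by right.
move=> {}n x y [->|[-> ->]] t; first by split=> //; left.
rewrite actM secM !act_directed !sec_directed; split=> //.
case: ifP => _; first by right.
by left; case: ifP => _; rewrite ?mulg1 // rhoM rootedM.
Qed.


Implicit Types n k : nat.

Lemma act_invK n (g : W n) t : act g^-1 (act g t) = t.
Proof. by rewrite -actM mulgV act1. Qed.

Lemma act_invKV n (g : W n) t : act g (act g^-1 t) = t.
Proof. by rewrite -actM mulVg act1. Qed.

Lemma sec_inv n (g : W n) t : sec g^-1 t = (sec g (act g^-1 t))^-1.
Proof.
by apply: (mulIg (sec g (act g^-1 t))); rewrite -secM !mulVg sec1.
Qed.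

Lemma sec_conj n (x g : W n) t : (forall u, act x u = u) ->
  sec (x ^ g) t = (sec x (act g^-1 t)) ^ (sec g (act g^-1 t)).
Proof. by move=> xid; rewrite !conjgE !secM xid sec_inv. Qed.

Lemma act_conj n (x g : W n) t : (forall u, act x u = u) -> act (x ^ g) t = t.
Proof. by move=> xid; rewrite !conjgE !actM xid act_invKV. Qed.

Lemma rootedV n (s : S n) : rooted s^-1 = (rooted s)^-1.
Proof. exact: group_morphV (@rootedM n) s. Qed.

Lemma rootedR n (s t : S n) : rooted [~ s, t] = [~ rooted s, rooted t].
Proof. by rewrite !commgEl rootedM rootedV (group_morphJ (@rootedM n)). Qed.

Lemma directed1 n : directed n 1 = 1.
Proof. exact: group_morph1 (@directedM n). Qed.

Lemma directedV n g : directed n g^-1 = (directed n g)^-1.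
Proof. exact: group_morphV (@directedM n) g. Qed.

Lemma insM n (t : S n) : {morph ins1 t : h k / h * k}.
Proof.
move=> h k; apply: aut_act_sec_ext => u; first by rewrite actM !act_ins.
by rewrite secM act_ins !sec_ins; case: eqP; rewrite ?mulg1.
Qed.

Lemma insV n (t : S n) h : ins1 t h^-1 = (ins1 t h)^-1.
Proof. exact: group_morphV (@insM n t) h. Qed.

(** In particular, conjugation by a rooted element carries an insertion to any other letter without
    changing what is inserted. *)
Lemma ins_conj n (t : S n) h g :
  (ins1 t h) ^ g = ins1 (act g t) (h ^ sec g t).
Proof.
apply: aut_act_sec_ext => u.
  by rewrite act_conj ?act_ins // => v; rewrite act_ins.
rewrite sec_conj; last by move=> v; rewrite act_ins.
rewrite !sec_ins; case: (eqVneq u (act g t)) => [->|ut].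
  by rewrite act_invK eqxx.
case: eqP => [e|]; last by rewrite conj1g.
by move: ut; rewrite -e act_invKV eqxx.
Qed.

(** Following [1] and then [a] reads off [rho m g] for [m > n] only, which is why [rho_faithful]
    concerns every tail. *)
Lemma directed_eq_rooted n g q : directed n g = rooted q -> g = 1.
Proof.
move=> e; have q1 : q = 1.
  have := @act_directed n g 1; rewrite e act_rooted mul1g //.
have {q q1 e} e : directed n g = 1 by rewrite e q1 rooted1.
have dm k : directed (k + n) g = 1.
  elim: k => [//|k IHk]; rewrite addSn.
  by have := @sec_directed (k + n) g 1; rewrite IHk eqxx sec1.
have a1 m : a m != 1.
  by apply/eqP => am; have := a_notin m; rewrite am group1.
apply: (@rho_faithful n.+1) => [[//|m]]; rewrite ltnS => nm.
have := @sec_directed m g (a m).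
rewrite -(subnK nm) dm sec1 eqxx (negPf (a1 _)) /= => /(congr1 (fun h => act h 1)).
by rewrite act1 act_rooted mul1g.
Qed.

Lemma directed_inj n : injective (directed n).
Proof.
move=> g h e; apply/eqP; rewrite -divg_eq1; apply/eqP.
by apply: (@directed_eq_rooted n _ 1); rewrite rooted1 directedM directedV e mulgV.
Qed.

(** * The groups generated by rooted and directed automorphisms *)

Definition Gam n (M : set G) : set (W n) :=
  subgroup_generated (range (@rooted n) `|` [set directed n m | m in M]).

Arguments Gam n M : clear implicits.

Lemma Gam_subgroup n M : is_subgroup (Gam n M).
Proof. exact: is_subgroup_generated. Qed.
Hint Resolve Gam_subgroup : core.

Lemma Gam_rooted n M s : Gam n M (rooted s).
Proof. by apply: sub_generated; left; exists s. Qed.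
Hint Resolve Gam_rooted : core.

Lemma Gam_directed n (M : set G) m : M m -> Gam n M (directed n m).
Proof. by move=> Mm; apply: sub_generated; right; exists m. Qed.

Lemma Gam_sub n (M : set G) (H : set (W n)) : is_subgroup H ->
  (forall s, H (rooted s)) -> (forall m, M m -> H (directed n m)) ->
  Gam n M `<=` H.
Proof.
by move=> HP Hr Hd; apply: generated_sub => // x [[s _ <-]|[m Mm <-]]; auto.
Qed.

Lemma Gam_mono n (M N : set G) : M `<=` N -> Gam n M `<=` Gam n N.
Proof. by move=> MN; apply: Gam_sub => // m /MN; exact: Gam_directed. Qed.

Lemma Gam_act n M g : Gam n M g -> exists s, forall t, act g t = t * s.
Proof.
move: g; apply: Gam_sub; last first.
- by move=> m _; exists 1 => t; rewrite act_directed mulg1.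
- by move=> s; exists s => t; rewrite act_rooted.
split=> [|g h [s gs] [t ht]|g [s gs]].
- by exists 1 => t; rewrite act1 mulg1.
- by exists (s * t) => u; rewrite actM gs ht mulgA.
- by exists s^-1 => t; rewrite -{1}[t](mulgKV s) -gs act_invK.
Qed.

Lemma Gam_sec n (M : set G) g t : Gam n M g -> Gam n.+1 M (sec g t).
Proof.
move=> Gg; move: g Gg t; apply: Gam_sub; last first.
- move=> m Mm t; rewrite sec_directed; case: eqP => _; first exact: Gam_directed.
  by case: ifP => // _; have [] := Gam_subgroup n.+1 M.
- by move=> s t; rewrite sec_rooted; have [] := Gam_subgroup n.+1 M.
have [G1 GM GV] := Gam_subgroup n.+1 M.
split=> [t|g h Gg Gh t|g Gg t].
- by rewrite sec1.
- by rewrite secM; apply: GM.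
- by rewrite sec_inv; apply: GV.
Qed.

(** Both elements fix the first layer, so commutators are taken section by section. Sections of the
    first are trivial outside [1], [a], [a * b], those of the second outside [b], [a * b],
    [a * b * b]; these sets meet only in [a * b]. *)
Lemma directed_commg n g h :
  [~ directed n g, directed n h ^ rooted (b n)]
    = ins1 (a n * b n) (rooted [~ rho n.+1 g, rho n.+1 h]).
Proof.
set x := directed n g; set y := directed n h ^ rooted (b n).
have xid t : act x t = t by exact: act_directed.
have yid t : act y t = t by apply: act_conj => u; exact: act_directed.
have xVid t : act x^-1 t = t by rewrite -{1}[t]xid act_invK.
apply: aut_act_sec_ext => t.
  by rewrite commgEl actM xVid act_conj // act_ins.
have -> : sec [~ x, y] t = [~ sec x t, sec y t].
  rewrite commgEl secM xVid sec_inv xVid sec_conj //.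
  suff -> : act y^-1 t = t by [].
  by rewrite -{1}[t]yid act_invK.
have -> : sec y t = sec (directed n h) (t * (b n)^-1).
  rewrite sec_conj; last by move=> u; exact: act_directed.
  by rewrite sec_rooted conjg1 -rootedV act_rooted.
rewrite sec_ins !sec_directed.
have bX i : b n ^+ i \in <[b n]> := mem_cycle _ i.
have ab i : (a n == b n ^+ i) = false.
  by apply/negP => /eqP ai; have := a_notin n; rewrite ai bX.
have abV i : (a n == b n ^- i) = false.
  by apply/negP => /eqP ai; have := a_notin n; rewrite ai groupV bX.
have b1 : (b n == 1) = false.
  by apply/negP => /eqP bn; have := b_sqr n; rewrite bn mulg1 eqxx.
have ab1 : (a n * b n == 1) = false.
  by rewrite mulg_eq1; exact: (abV 1%N).
have a1 : (a n == 1) = false := ab 0%N.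
have [->|tab] := eqVneq t (a n * b n).
  by rewrite mulgK ab1 eqxx a1 orbT /= rootedR.
have [->|t1] := eqVneq t 1.
  rewrite mul1g invg_eq1 b1.
  have -> : ((b n)^-1 == a n) = false by rewrite eq_sym; exact: (abV 1%N).
  have -> : ((b n)^-1 == a n * b n) = false.
    by rewrite -divg_eq eq_sym -invgM; exact: (abV 2%N).
  by rewrite commg1.
have [->|ta] := eqVneq t (a n); last by rewrite comm1g.
have -> : (a n * (b n)^-1 == 1) = false.
  by rewrite divg_eq mul1g; exact: (ab 1%N).
have -> : (a n * (b n)^-1 == a n) = false.
  by rewrite divg_eq -{1}[a n]mulg1 (inj_eq (mulgI _)) eq_sym.
have -> : (a n * (b n)^-1 == a n * b n) = false.
  rewrite (inj_eq (mulgI _)) eq_sym -mulg_eq1; exact/negbTE/b_sqr.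
by rewrite commg1.
Qed.

Definition dense (M : set G) := forall n s, exists2 m, M m & rho n m = s.

Lemma denseT : dense setT.
Proof. by move=> n s; have [g] := rho_surj s; exists g. Qed.

Section Dense.
Variable M : set G.
Hypotheses (MP : is_subgroup M) (Md : dense M).

(** The [u] for which [rooted u] can be inserted at [a * b] form a subgroup, containing all
    commutators by [directed_commg] and density. Perfectness makes it everything, and rooted
    conjugation reaches the other letters. *)
Lemma Gam_ins_rooted n t s : Gam n M (ins1 t (rooted s)).
Proof.
have [_ GM GV] := Gam_subgroup n M.
suff Hab u : Gam n M (ins1 (a n * b n) (rooted u)).
  have := @ins_conj n (a n * b n) (rooted s) (rooted ((a n * b n)^-1 * t)).
  rewrite act_rooted sec_rooted conjg1 mulVKg => <-.
  apply: (subgroupJ (Gam_subgroup n M)); [exact: Hab|exact: Gam_rooted].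
pose P u := Gam n M (ins1 (a n * b n) (rooted u)).
move: u; apply: (perfect_subgroup (P := P)).
- exact: S_perfect.
- apply: (@morph_is_subgroup _ _ (fun u => ins1 (a n * b n) (rooted u))) => // u v.
  by rewrite rootedM insM.
- move=> u v; have [m Mm <-] := Md u; have [k Mk <-] := Md v.
  rewrite /P -directed_commg commgEl.
  have Gk : Gam n M (directed n k ^ rooted (b n)).
    by apply: (subgroupJ (Gam_subgroup n M)); [exact: Gam_directed|exact: Gam_rooted].
  apply: (GM); first by apply: GV; exact: Gam_directed.
  by apply: (subgroupJ (Gam_subgroup n M)) => //; exact: Gam_directed.
Qed.

(** Removing from [directed n m] its rooted sections at [a] and [a * b] leaves [directed n.+1 m]
    inserted at [1]; rooted conjugation carries [1] to [t]. *)
Lemma Gam_ins n t h : Gam n.+1 M h -> Gam n M (ins1 t h).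
Proof.
have ins1_d m : M m -> Gam n M (ins1 1 (directed n.+1 m)).
  move=> Mm.
  have -> : ins1 1 (directed n.+1 m) = directed n m *
     ((ins1 (a n) (rooted (rho n.+1 m)))^-1 *
      (ins1 (a n * b n) (rooted (rho n.+1 m)))^-1).
    have a1 : (a n == 1) = false.
      by apply/negP => /eqP an; have := a_notin n; rewrite an group1.
    have ab1 : (a n * b n == 1) = false.
      rewrite mulg_eq1; apply/negP => /eqP an; have := a_notin n.
      by rewrite an groupV cycle_id.
    have aab : (a n == a n * b n) = false.
      rewrite -{1}[a n]mulg1 (inj_eq (mulgI _)) eq_sym; apply/negP => /eqP bn.
      by have := b_sqr n; rewrite bn mulg1 eqxx.
    rewrite -!insV; apply: aut_act_sec_ext => u.
      by rewrite !actM !act_ins act_directed.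
    rewrite !secM !act_ins act_directed !sec_ins sec_directed.
    have [->|u1] := eqVneq u 1.
      by rewrite eq_sym a1 eq_sym ab1 !mulg1.
    have [->|ua] := eqVneq u (a n); first by rewrite aab mulg1 mulgV.
    by case: eqP => _ /=; rewrite ?mul1g ?mulgV ?mulg1.
  have [_ GM GV] := Gam_subgroup n M.
  by apply: (GM); [exact: Gam_directed|apply: (GM); apply: GV; exact: Gam_ins_rooted].
have ins1_h : Gam n.+1 M `<=` [set h | Gam n M (ins1 1 h)].
  apply: Gam_sub => //; last by move=> s; exact: Gam_ins_rooted.
  by apply: morph_is_subgroup => //; exact: insM.
move=> /ins1_h /= Gh.
have := @ins_conj n 1 h (rooted t); rewrite act_rooted sec_rooted conjg1 mul1g => <-.
by apply: (subgroupJ (Gam_subgroup n M)) => //; exact: Gam_rooted.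
Qed.

End Dense.

(** The product of the insertions of all sections of [g] is [g] up to its rooted part. *)
Lemma assemble n (L : set (W n)) g s : is_subgroup L ->
  (forall t, L (ins1 t (sec g t))) -> L (rooted s) ->
  (forall t, act g t = t * s) -> L g.
Proof.
move=> LP Ls Lr gs; have [L1 LM LV] := LP.
have H (l : seq (S n)) : uniq l -> exists h, [/\ L h, forall t, act h t = t &
    forall t, sec h t = if t \in l then sec g t else 1].
  elim: l => [|u l IHl] /=.
    by move=> _; exists 1; split=> // t; rewrite ?act1 ?sec1.
  case/andP=> ul /IHl[h [Lh h1 h2]]; exists (ins1 u (sec g u) * h).
  split=> [|t|t]; first by apply: (LM).
    by rewrite actM act_ins.
  rewrite secM act_ins sec_ins h2 in_cons.
  case: eqP => [->|_] /=; first by rewrite (negPf ul) mulg1.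
  by rewrite mul1g.
have [h [Lh h1 h2]] := H _ (enum_uniq (S n)).
suff -> : g = h * rooted s by apply: (LM).
apply: aut_act_sec_ext => t; first by rewrite gs actM h1 act_rooted.
by rewrite secM sec_rooted mulg1 h2 mem_enum.
Qed.

Lemma Gam_assemble n (M : set G) g s : is_subgroup M -> dense M ->
  (forall t, Gam n.+1 M (sec g t)) -> (forall t, act g t = t * s) -> Gam n M g.
Proof.
move=> MP Md Gg gs; apply: assemble gs => // t.
exact: Gam_ins.
Qed.

(** * Products of conjugates of directed automorphisms *)

Inductive dprod n (M : set G) : nat -> W n -> Prop :=
| dprod0 : dprod M 0 1
| dprodS k c m p : dprod M k c -> M m -> dprod M k.+1 (c * directed n m ^ rooted p).

Lemma mul_rooted_directed n c (q : S n) m :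
  c * rooted q * directed n m = c * directed n m ^ rooted q^-1 * rooted q.
Proof. by rewrite conjgE rootedV invgK -!mulgA mulVg mulg1. Qed.

Lemma Gam_dprod n (M : set G) g : is_subgroup M -> Gam n M g ->
  exists k c q, dprod M k c /\ g = c * rooted q.
Proof.
move=> [M1 _ MV].
pose P g := exists k c (q : S n), dprod M k c /\ g = c * rooted q.
(* Right multipliers preserving the normal form; including [y^-1] makes them a subgroup. *)
pose H : set (W n) := [set y | forall x, P x -> P (x * y) /\ P (x * y^-1)].
have HP : is_subgroup H.
  split=> [x Px|y z Hy Hz x Px|y Hy x Px].
  - by rewrite invg1 mulg1.
  - have [Pxy _] := Hy _ Px; have [_ Pxz] := Hz _ Px.
    rewrite invgM !mulgA; split; first by have [] := Hz _ Pxy.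
    by have [] := Hy _ Pxz.
  - by rewrite invgK; have [] := Hy _ Px.
have Hr x s : P x -> P (x * rooted s).
  by move=> [k [c [q [kc ->]]]]; exists k, c, (q * s); rewrite rootedM mulgA.
have Hd x m : M m -> P x -> P (x * directed n m).
  move=> Mm [k [c [q [kc ->]]]]; exists k.+1, (c * directed n m ^ rooted q^-1), q.
  by split; [exact: dprodS|rewrite mul_rooted_directed].
have P1 : P 1 by exists 0%N, 1, 1; split; [exact: dprod0|rewrite rooted1 mulg1].
move=> Gg; suff /(_ g Gg 1 P1)[] : Gam n M `<=` H by rewrite mul1g.
apply: Gam_sub => // [s|m Mm] x Px.
- by rewrite -rootedV; split; exact: Hr.
- by rewrite -directedV; split; apply: Hd => //; exact: MV.
Qed.

Lemma dprod_act n (M : set G) k c (t : S n) : dprod M k c -> act c t = t.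
Proof.
elim=> [|{}k {}c m p _ IHc _]; first by rewrite act1.
by rewrite actM IHc act_conj // => u; exact: act_directed.
Qed.

Lemma dprod0_eq n (M : set G) (c : W n) : dprod M 0 c -> c = 1.
Proof. by move=> H; inversion H. Qed.

Lemma sec_directed_conj n m (p t : S n) :
  sec (directed n m ^ rooted p) t = directed n.+1 m \/
  exists s, sec (directed n m ^ rooted p) t = rooted s.
Proof.
rewrite sec_conj; last by move=> u; exact: act_directed.
rewrite sec_rooted conjg1 sec_directed; case: ifP => _; first by left.
by right; case: ifP => _; [exists (rho n.+1 m)|exists 1; rewrite rooted1].
Qed.

(* Directed factors that all contribute to the same section are not separated
   by rooted elements there, so they merge into a single one. *)
Lemma dprod_sec n (M : set G) k c (t : S n) : is_subgroup M -> dprod M k c ->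
  (exists2 m, M m & sec c t = directed n.+1 m) \/
  (exists j c' q, [/\ j < k, dprod M j c' & sec c t = c' * rooted q]).
Proof.
move=> [M1 MM _]; elim=> [|{}k {}c m p kc IHc Mm].
  by left; exists 1; rewrite // sec1 directed1.
rewrite secM (dprod_act _ kc).
have [->|[s ->]] := sec_directed_conj m p t.
  case: IHc => [[m' Mm' ->]|[j [c' [q [jk jc' ->]]]]].
    by left; exists (m' * m); [exact: MM|rewrite directedM].
  right; exists j.+1, (c' * directed n.+1 m ^ rooted q^-1), q.
  by split=> //; [exact: dprodS|rewrite mul_rooted_directed].
(* The last factor gives a rooted section. Earlier factors that merged count as one, which is fewer
   than the total if there were any; otherwise no directed factor is left. *)
right; case: k kc IHc => [|k] kc IHc.
  exists 0%N, 1, s; split=> //; first exact: dprod0.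
  by rewrite (dprod0_eq kc) sec1.
case: IHc => [[m' Mm' ->]|[j [c' [q [jk jc' ->]]]]].
  exists 1%N, (1 * directed n.+1 m' ^ rooted 1), s; split=> //.
    by apply: dprodS => //; exact: dprod0.
  by rewrite rooted1 conjg1 mul1g.
exists j, c', (q * s); split=> //; first exact: leq_trans jk _.
by rewrite rootedM mulgA.
Qed.

(** Sections at [1] keep the left side directed by [g], while the right side loses factors until it
    is directed by an element of [M]. *)
Lemma dprod_directed n (M : set G) k c q g : is_subgroup M ->
  dprod M k c -> directed n g = c * rooted q -> M g.
Proof.
move=> MP; elim/ltn_ind: k n c q g => k IHk n c q g kc e.
have q1 : q = 1.
  have := @act_directed n g 1.
  by rewrite e actM (dprod_act _ kc) act_rooted mul1g.
have := @sec_directed n g 1; rewrite eqxx e secM sec_rooted mulg1.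
have [[m Mm ->]|[j [c' [q' [jk jc' ->]]]]] := dprod_sec 1 MP kc.
  by move/directed_inj => <-.
by move/esym; exact: IHk jk _ _ _ _ jc'.
Qed.

Lemma Gam_directed_inv n (M : set G) g :
  is_subgroup M -> Gam n M (directed n g) -> M g.
Proof.
by move=> MP /(Gam_dprod MP)[k [c [q [kc]]]]; apply: dprod_directed kc.
Qed.

(** The [h] that [L] contains inserted at [act g t] form a subgroup containing [D] and its conjugate
    by [sec g t], hence [Gam n.+1 setT]. Rooted elements spread these insertions to all letters, and
    [assemble] concludes. *)
Lemma abnormal_lift n (D : set (W n.+1)) (E : set (W n)) g t :
  (forall s, E (rooted s)) -> (forall u h, D h -> E (ins1 u h)) ->
  abnormal (Gam n.+1 setT) D (sec g t) -> abnormal (Gam n setT) E g.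
Proof.
move=> Er Ei abn L LP EL EgL.
have LG h : Gam n.+1 setT h -> L (ins1 (act g t) h).
  move: h; apply: (abn [set h | L (ins1 (act g t) h)]).
  - exact: (morph_is_subgroup (@insM _ _) LP).
  - by move=> h Dh; apply: EL; exact: Ei.
  - by move=> h Dh /=; rewrite -ins_conj; apply: EgL; exact: Ei.
move=> h Gh; have [s hs] := Gam_act Gh; apply: (assemble LP _ _ hs).
  move=> u; have := @ins_conj n (act g t) (sec h u) (rooted ((act g t)^-1 * u)).
  rewrite act_rooted sec_rooted conjg1 mulVKg => <-.
  by apply: (subgroupJ LP); [apply: LG; exact: Gam_sec|apply: EL].
exact: EL.
Qed.

(** * Lifts of subgroups mapping onto every factor *)

Section DenseAbnormal.
Variable M : set G.
Hypotheses (MP : is_subgroup M) (Md : dense M).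
Hypothesis Mab : forall g, ~ M g -> abnormal [set: G] M g.

Lemma directed_abnormal n g :
  ~ M g -> abnormal (Gam n setT) (Gam n M) (directed n g).
Proof.
move=> Mg L LP ML MgL.
suff H : [set: G] `<=` [set h | L (directed n h)].
  by apply: Gam_sub => [//|s|m _]; [exact: ML|exact: H].
apply: (Mab Mg); first exact: (morph_is_subgroup (@directedM n) LP).
- by move=> m Mm; apply: ML; exact: Gam_directed.
- move=> m Mm; rewrite /= (group_morphJ (@directedM n)).
  by apply: MgL; exact: Gam_directed.
Qed.

(** A single factor is directed up to rooted elements. With more factors, some section lies outside
    [Gam n.+1 M], since otherwise [c] could be assembled, and that section has fewer factors. *)
Lemma dprod_abnormal n k c : dprod [set: G] k c -> ~ Gam n M c ->
  abnormal (Gam n setT) (Gam n M) c.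
Proof.
elim/ltn_ind: k n c => k IHk n c kc Mc.
case: k kc IHk => [|[|k]] kc IHk.
- by case: Mc; rewrite (dprod0_eq kc); have [] := Gam_subgroup n M.
- inversion kc as [|k' c' m p kc' _ e1 e2].
  rewrite -e2 (dprod0_eq kc') mul1g in Mc *.
  rewrite conjgE; apply: abnormal_mull => //; first by rewrite -rootedV.
  apply: abnormal_mulr => //; apply: directed_abnormal => Mm; apply: Mc.
  by apply: (subgroupJ (Gam_subgroup n M)) => //; exact: Gam_directed.
have [t Mt] : exists t, ~ Gam n.+1 M (sec c t).
  apply/existsNP => Mt; apply: Mc; apply: (Gam_assemble (s := 1)) => // t.
  by rewrite (dprod_act _ kc) mulg1.
apply: (@abnormal_lift n (Gam n.+1 M) _ c t) => //.
  by move=> u h; exact: Gam_ins.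
have [[m Mm e]|[j [c' [q [jk jc' e]]]]] := dprod_sec t (is_subgroupT G) kc.
  rewrite e; have -> : directed n.+1 m = 1 * directed n.+1 m ^ rooted 1.
    by rewrite rooted1 conjg1 mul1g.
  apply: (IHk 1%N) => //; first by apply: dprodS => //; exact: dprod0.
  by rewrite rooted1 conjg1 mul1g -e.
rewrite e; apply: abnormal_mulr => //; apply: IHk jk _ _ jc' _ => Mc'.
by apply: Mt; rewrite e; have [_ GM _] := Gam_subgroup n.+1 M; apply: GM.
Qed.

Lemma Gam_abnormal n g : Gam n setT g -> ~ Gam n M g ->
  abnormal (Gam n setT) (Gam n M) g.
Proof.
move=> /(Gam_dprod (is_subgroupT G))[k [c [q [kc ->]]]] Mg.
apply: abnormal_mulr => //; apply: dprod_abnormal kc _ => Mc; apply: Mg.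
by have [_ GM _] := Gam_subgroup n M; apply: GM.
Qed.

End DenseAbnormal.

(** * Subgroups prescribed at one level *)

Fixpoint level_stab k n (K : set G) : set (W n) :=
  if k is k'.+1
  then [set g | Gam n setT g /\ forall t, level_stab k' K (sec g t)]
  else [set g | Gam n setT g /\ exists2 m, K m & forall t, act g t = t * rho n m].
Arguments level_stab k n K : clear implicits.

Lemma level_stab_Gam k n K : level_stab k n K `<=` Gam n setT.
Proof. by case: k => [|k] g []. Qed.

Lemma rho1 n : rho n 1 = 1.
Proof. exact: group_morph1 (@rhoM n). Qed.

Lemma rhoV n g : rho n g^-1 = (rho n g)^-1.
Proof. exact: group_morphV (@rhoM n) g. Qed.

Section LevelStab.
Variable K : set G.
Hypothesis KP : is_subgroup K.

Lemma level_stab_subgroup k n : is_subgroup (level_stab k n K).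
Proof.
have [K1 KM KV] := KP.
elim: k n => [|k IHk] n; have [G1 GM GV] := Gam_subgroup n setT.
  split=> [|g h [Gg [x Kx gx]] [Gh [y Ky hy]]|g [Gg [x Kx gx]]].
  - by split=> //; exists 1 => // t; rewrite act1 rho1 mulg1.
  - split; first exact: GM.
    by exists (x * y); [exact: KM|move=> t; rewrite actM gx hy rhoM mulgA].
  - split; first exact: GV.
    exists x^-1; first exact: KV.
    by move=> t; rewrite rhoV -{1}[t](mulgKV (rho n x)) -gx act_invK.
have [H1 HM HV] := IHk n.+1.
split=> [|g h [Gg gx] [Gh hy]|g [Gg gx]].
- by split=> // t; rewrite sec1.
- split=> [|t]; first exact: GM.
  by rewrite secM; apply: HM; [exact: gx|exact: hy].
- split=> [|t]; first exact: GV.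
  by rewrite sec_inv; apply: HV; exact: gx.
Qed.

Lemma level_stab_rooted k n s : level_stab k.+1 n K (rooted s).
Proof.
by split=> // t; rewrite sec_rooted; have [] := level_stab_subgroup k n.+1.
Qed.

Lemma level_stab_ins k n t h :
  level_stab k n.+1 K h -> level_stab k.+1 n K (ins1 t h).
Proof.
move=> Kh; split.
  by apply: Gam_ins => //; [exact: denseT|exact: level_stab_Gam Kh].
move=> u; rewrite sec_ins; case: eqP => // _.
by have [] := level_stab_subgroup k n.+1.
Qed.

(** For [k = 0] the subgroup contains every element of [Gam n setT] fixing the first layer, so [g]
    may be taken rooted and the claim pulled back to [G] along [rho n]. Larger [k] follow by
    [abnormal_lift]. *)
Lemma level_stab_abnormal k n g :
  (forall h, ~ K h -> abnormal [set: G] K h) ->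
  Gam n setT g -> ~ level_stab k n K g ->
  abnormal (Gam n setT) (level_stab k n K) g.
Proof.
move=> Kab; have [K1 KM KV] := KP.
have GTP m := Gam_subgroup m setT.
elim: k n g => [|k IHk] n g Gg Kg.
  have [s gs] := Gam_act Gg; have [x xs] := rho_surj s.
  have Kx : ~ K x by move=> Kx; apply: Kg; split=> //; exists x; rewrite ?xs.
  have fixK h u : Gam n setT h -> (forall t, act h t = t * u) ->
      level_stab 0 n K (h * rooted u^-1).
    move=> Gh hu; split; first by have [_ GM _] := GTP n; apply: GM.
    by exists 1 => // t; rewrite actM hu act_rooted mulgK rho1 mulg1.
  have -> : g = (g * rooted s^-1) * rooted s by rewrite rootedV mulgVK.
  apply: abnormal_mull; [exact: level_stab_subgroup|exact: fixK|].
  move=> L LP KL KsL.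
  have Lr u : L (rooted u).
    have [y <-] := rho_surj u.
    suff H : [set: G] `<=` [set h | L (rooted (rho n h))] by exact: H.
    have Kr h : K h -> level_stab 0 n K (rooted (rho n h)).
      by move=> Kh; split=> //; exists h => // t; rewrite act_rooted.
    apply: (Kab _ Kx).
    - apply: (@morph_is_subgroup _ _ (fun h => rooted (rho n h))) => // h h'.
      by rewrite rhoM rootedM.
    - by move=> h /Kr; exact: KL.
    - move=> h /Kr/KsL.
      by rewrite /= -xs (group_morphJ (@rhoM n)) (group_morphJ (@rootedM n)).
  move=> h Gh; have [u hu] := Gam_act Gh.
  have -> : h = (h * rooted u^-1) * rooted u by rewrite rootedV mulgVK.
  by have [_ LM _] := LP; apply: (LM) => //; apply: KL; exact: fixK.
have [t Kt] : exists t, ~ level_stab k n.+1 K (sec g t).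
  by apply/existsNP => Kt; apply: Kg.
apply: (@abnormal_lift n (level_stab k n.+1 K) _ g t).
- by move=> s; exact: level_stab_rooted.
- by move=> u h; exact: level_stab_ins.
- by apply: IHk => //; exact: Gam_sec.
Qed.

End LevelStab.

(* Which of these elements lie in a lift tells which subgroup it is the lift of. *)
Fixpoint deep j n (g : G) : W n :=
  if j is j'.+1 then ins1 1 (deep j' n.+1 g) else rooted (rho n g).
Arguments deep j n g : clear implicits.

Lemma Gam_deep (M : set G) j n g : is_subgroup M -> dense M -> Gam n M (deep j n g).
Proof. by move=> MP Md; elim: j n => [|j IHj] n //=; exact: Gam_ins. Qed.

(** If [j] differs from [k], the sections of [deep j n g] at depth [k] act trivially on letters, so
    nothing is asked of [g]. *)
Lemma level_stab_deep (K : set G) k j n g : is_subgroup K -> (j = k -> K g) ->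
  level_stab k n K (deep j n g).
Proof.
move=> KP; have [K1 _ _] := KP.
elim: k j n => [|k IHk] [|j] n jk /=.
- by split=> //; exists g => [|t]; [exact: jk|rewrite act_rooted].
- split; first exact: (@Gam_deep _ j.+1 n g _ denseT).
  by exists 1 => // t; rewrite act_ins rho1 mulg1.
- exact: level_stab_rooted.
- by apply: level_stab_ins => //; apply: IHk => jk'; apply: jk; rewrite jk'.
Qed.

Lemma level_stab_deep_inv (K : set G) k n g : level_stab k n K (deep k n g) ->
  exists2 m, K m & rho (k + n) g = rho (k + n) m.
Proof.
elim: k n => [|k IHk] n /= [_].
  by move=> [m Km /(_ 1)]; rewrite act_rooted !mul1g => e; exists m.
by move=> /(_ 1); rewrite sec_ins eqxx => /IHk; rewrite addSnnS.
Qed.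

(** * Lifting nonnormal maximal subgroups *)

Definition nonnormal_maximal : set (set G) :=
  [set K | maximal_subgroup [set: G] K /\ ~ normal_in [set: G] K].

Definition omits (M : set G) k := ~ forall s, exists2 m, M m & rho k m = s.

Lemma not_dense M : ~ dense M -> exists k, omits M k.
Proof. by move/existsNP. Qed.

(** The preimage under [rho k] of the image of [M] is a proper subgroup containing [M], hence equal
    to [M]. *)
Lemma maximal_omits M k g m : maximal_subgroup [set: G] M -> omits M k ->
  M m -> rho k g = rho k m -> M g.
Proof.
move=> [MP [_ MT] maxM] Mk Mm gm; have [M1 MM MV] := MP.
pose L := [set h | exists2 x, M x & rho k h = rho k x].
have LP : is_subgroup L.
  split=> [|h h' [x Mx hx] [y My hy]|h [x Mx hx]].
  - by exists 1.
  - by exists (x * y); [exact: MM|rewrite !rhoM hx hy].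
  - by exists x^-1; [exact: MV|rewrite !rhoV hx].
have ML : M `<=` L by move=> x Mx; exists x.
have [<-|LT] := maxM _ LP ML (subsetT _); first by exists m.
case: Mk => s; have [h <-] := rho_surj s.
have [x Mx ->] : L h by rewrite LT.
by exists x.
Qed.

Definition max_lift (M : set G) : set (W 0) :=
  if pselect (dense M) then Gam 0 M
  else level_stab (xget 0%N (omits M)) 0 M.

Variant max_lift_spec (M : set G) : set (W 0) -> Prop :=
| MaxLiftDense of dense M : max_lift_spec M (Gam 0 M)
| MaxLiftStab k of omits M k : max_lift_spec M (level_stab k 0 M).

Lemma max_liftP M : max_lift_spec M (max_lift M).
Proof.
rewrite /max_lift; case: pselect => [Md|Md]; first by left.
by right; apply: xgetPex; exact: not_dense.
Qed.

Lemma nonnormal_maximal_neqT M : nonnormal_maximal M -> exists g, ~ M g.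
Proof.
move=> [[_ [_ MT] _] _]; apply/existsNP => H; apply: MT => g _; exact: H.
Qed.

Lemma max_lift_maximal M :
  nonnormal_maximal M -> maximal_subgroup (Gam 0 setT) (max_lift M).
Proof.
move=> MN; have [g0 Mg0] := nonnormal_maximal_neqT MN.
have [maxM nM] := MN; have [MP _ _] := maxM.
have Mab g : ~ M g -> abnormal [set: G] M g.
  exact: nonnormal_maximal_abnormal.
case: max_liftP => [Md|k Mk].
- apply: abnormal_maximal => //.
  + split; first exact: Gam_mono.
    by move=> H; exact: Mg0 (Gam_directed_inv MP (H _ (@Gam_directed 0 setT g0 I))).
  + by move=> g; exact: Gam_abnormal.
- apply: abnormal_maximal; first exact: level_stab_subgroup.
  + split; first exact: level_stab_Gam.
    move=> H; have := H _ (@Gam_deep setT k 0 g0 (is_subgroupT G) denseT).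
    move/level_stab_deep_inv => [m Mm]; rewrite addn0 => e.
    by apply: Mg0; exact: maximal_omits Mm e.
  + by move=> g; exact: level_stab_abnormal.
Qed.

(** Directed elements recover [M] from a lift of the first kind, deep ones at the chosen level from
    one of the second. Only a lift of the first kind contains every deep element. *)
Lemma max_lift_inj M N : nonnormal_maximal M -> nonnormal_maximal N ->
  max_lift M = max_lift N -> M = N.
Proof.
have deep_k P k g : nonnormal_maximal P -> omits P k ->
    level_stab k 0 P (deep k 0 g) -> P g.
  move=> [maxP _] Pk /level_stab_deep_inv[m Pm]; rewrite addn0.
  exact: maximal_omits.
have dense_stab P Q k : nonnormal_maximal P -> nonnormal_maximal Q ->
    dense P -> omits Q k -> Gam 0 P <> level_stab k 0 Q.
  move=> [[PP _ _] _] QN Pd Qk PQ; have [g Qg] := nonnormal_maximal_neqT QN.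
  apply: Qg; apply: (deep_k Q k g) => //; rewrite -PQ; exact: Gam_deep.
(* The levels [k] and [l] may differ; for [g] in [Q], [deep k 0 g] lies in the stabiliser at [l] in
   either case. *)
have stab_sub P Q k l : nonnormal_maximal P -> nonnormal_maximal Q ->
    omits P k -> omits Q l -> level_stab k 0 P = level_stab l 0 Q -> Q `<=` P.
  move=> PN QN Pk Ql PQ g Qg; apply: (deep_k P k g) => //.
  by rewrite PQ; apply: level_stab_deep => //; have [[]] := QN.
move=> MN NN; case: max_liftP => [Md|k Mk]; case: max_liftP => [Nd|l Nl] e.
- have [[MP _ _] _] := MN; have [[NP _ _] _] := NN.
  apply/seteqP; split=> g Hg.
    by apply: (@Gam_directed_inv 0 N g NP); rewrite -e; exact: Gam_directed.
  by apply: (@Gam_directed_inv 0 M g MP); rewrite e; exact: Gam_directed.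
- by case: (dense_stab M N l).
- by case: (dense_stab N M k).
- by apply/seteqP; split; [apply: stab_sub (esym e)|apply: stab_sub e].
Qed.

(** * Finite generation, transitivity and layeredness *)

Lemma Gam_finitely_generated n :
  finitely_generated [set: G] -> finitely_generated (Gam n setT).
Proof.
move=> [E Efin ET]; exists (range (@rooted n) `|` [set directed n g | g in E]).
  rewrite finite_setU; split; apply: finite_image => //.
have HP := is_subgroup_generated (range (@rooted n) `|` [set directed n g | g in E]).
apply/seteqP; split.
- apply: Gam_sub => // [s|m _]; first by apply: sub_generated; left; exists s.
  suff H : [set: G] `<=` directed n @^-1` (subgroup_generated
      (range (@rooted n) `|` [set directed n g | g in E])) by exact: H.
  rewrite ET; apply: generated_sub; first exact: (morph_is_subgroup (@directedM n) HP).
  by move=> g Eg; apply: sub_generated; right; exists g.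
- apply: generated_sub => // x [[s _ <-]|[g _ <-]] //; exact: Gam_directed.
Qed.

Lemma Gam_transitive n : spherically_transitive (Gam n setT).
Proof.
move=> k; elim: k n => [|k IHk] n u v.
  move=> /size0nil u0 /size0nil v0; exists 1; last by apply: val_inj; rewrite u0 v0.
  by have [] := Gam_subgroup n setT.
have [->|[t [u' ->]]] := vconsP u; first by [].
have [->|[s [v' ->]]] := vconsP v; first by [].
move=> [uk] [vk]; have [g Gg gu] := IHk n.+1 u' v' uk vk.
exists (rooted (t^-1 * s) * ins1 s g).
  have [_ GM _] := Gam_subgroup n setT; apply: GM => //.
  by apply: Gam_ins => //; exact: denseT.
by rewrite aut_vcons actM act_rooted mulVKg act_ins secM sec_rooted act_rooted
  mulVKg sec_ins eqxx mul1g gu.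
Qed.

Lemma Gam_layered n : layered (Gam n setT).
Proof.
(* The section at [v] lives in a shifted tree; describing the insertion on strings lets the
   induction along [v] avoid transport. *)
suff H s k (g : W k) (v : vertex (letters S k)) : val v = s -> Gam k setT g ->
    exists2 h, Gam k setT h & forall u, val (h u) =
      if prefix (val v) (val u) then val v ++ drop (vlen v) (val (g u)) else val u.
  move=> g v Gg; have [h Gh hE] := H _ _ g v erefl Gg.
  suff -> : ins (section_at g v) = h by [].
  by apply: aut_ext => u; apply: val_inj; rewrite ins_sectionE hE.
elim: s k g v => [|i s IHs] k g v vs Gg.
  by exists g => // u; rewrite /vlen vs prefix0s drop0.
have [e|[t [v' e]]] := vconsP v; first by rewrite e in vs.
have [||h Gh hE] := IHs k.+1 (sec g t) v'.
- by move: vs; rewrite e => -[].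
- exact: Gam_sec.
exists (ins1 t h); first by apply: Gam_ins => //; exact: denseT.
move=> u; rewrite e; have [->|[t' [u' ->]]] := vconsP u; first by rewrite aut_root.
rewrite ins1_vcons aut_vcons /=; have [->|tt'] := eqVneq t' t.
  by rewrite eqxx /= hE; case: ifP.
by rewrite (can_eq (@encodeK _)) eq_sym (negPf tt').
Qed.

Lemma Gam_layered_branch n : layered_branch_group (Gam n setT).
Proof.
apply: layered_branch; first exact: Gam_subgroup.
- exact: Gam_layered.
- exact: Gam_transitive.
Qed.

End DirectedAutomorphisms.

(** * Choice of the alphabets *)

Lemma perfect_not_abelian (T : finGroupType) :
  perfect_group T -> 1 < #|T| -> ~~ abelian [set: T]%SET.
Proof.
move=> pT T1; apply/negP => /commG1P; rewrite pT => T1'.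
by move: T1; rewrite -cardsT T1' cards1.
Qed.

Lemma involutive_abelian (T : finGroupType) :
  (forall x : T, x * x = 1) -> abelian [set: T]%SET.
Proof.
move=> xx; have xV (x : T) : x^-1 = x by apply/eqP; rewrite eq_sym -mulg_eq1 xx.
by apply/centsP => x _ y _; rewrite /commute -[LHS]xV invMg !xV.
Qed.

(** A nontrivial perfect group is not abelian, so it is not cyclic and has an element with
    nontrivial square. *)
Lemma perfect_pair (T : finGroupType) : perfect_group T -> 1 < #|T| ->
  exists ab : T * T, ab.1 \notin <[ab.2]> /\ ab.2 * ab.2 != 1.
Proof.
move=> pT T1; have /negP nab := perfect_not_abelian pT T1.
have [b bb] : exists b : T, b * b != 1.
  apply: contrapT => /forallNP H; apply: nab; apply: involutive_abelian => x.
  by apply/eqP; apply: contrapT => /negP; exact: H.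
have [a ab] : exists a : T, a \notin <[b]>.
  apply: contrapT => /forallNP H; apply: nab.
  apply: abelianS (cycle_abelian b); apply/fintype.subsetP => x _.
  by apply: contrapT => /negP; exact: H.
by exists (a, b).
Qed.

Definition multiplicative_of (G H : groupType) (f : G -> H)
    (fM : {morph f : x y / x * y}) : {multiplicative G -> H} :=
  HB.pack f (isMultiplicative.Build G H f fM).

Lemma image_isomorphic (G H : groupType) (f : G -> H) :
  {morph f : x y / x * y} -> injective f -> isomorphic_to G (range f).
Proof. by move=> fM finj; exists (multiplicative_of fM). Qed.

Lemma range_is_subgroup (G H : groupType) (f : G -> H) :
  {morph f : x y / x * y} -> is_subgroup (range f).
Proof.
move=> fM; split=> [|_ _ [x _ <-] [y _ <-]|_ [x _ <-]].
- by exists 1; rewrite ?(group_morph1 fM).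
- by exists (x * y); rewrite ?fM.
- by exists x^-1; rewrite ?(group_morphV fM).
Qed.

Theorem layered_branch_overgroup (G : groupType) (S : nat -> finGroupType)
    (rho : forall n, G -> S n) :
  (forall n, {morph @rho n : x y / x * y}) ->
  (forall n s, exists g, @rho n g = s) ->
  (forall n g, (forall m, n <= m -> @rho m g = 1) -> g = 1) ->
  (forall n, perfect_group (S n)) -> (forall n, 1 < #|S n|) ->
  exists (A : choiceType) (X : nat -> {fset A}) (Gamma : set (tree_aut X)),
    [/\ tree_alphabets X, layered_branch_group Gamma,
        (exists H : set (tree_aut X),
            [/\ is_subgroup H, H `<=` Gamma & isomorphic_to G H]),
        (exists F : set G -> set (tree_aut X),
            set_fun (@nonnormal_maximal G) (maximal_subgroup Gamma) F /\
            set_inj (@nonnormal_maximal G) F) &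
        (finitely_generated [set: G] -> finitely_generated Gamma)].
Proof.
move=> rhoM rho_surj rho_faithful Sp S1.
pose ab n := cid (perfect_pair (Sp n) (S1 n)).
pose a n := (sval (ab n)).1; pose b n := (sval (ab n)).2.
have a_notin n : a n \notin <[b n]> by have [] := svalP (ab n).
have b_sqr n : b n * b n != 1 by have [] := svalP (ab n).
exists nat, (letters S 0), (@Gam G S rho a b rhoM 0 setT); split.
- by move=> n; rewrite card_alphabet.
- exact: Gam_layered_branch.
- exists (range (@directed G S rho a b rhoM 0)); split.
  + exact: range_is_subgroup (@directedM G S rho a b rhoM 0).
  + by move=> _ [g _ <-]; exact: Gam_directed.
  + apply: image_isomorphic; [exact: directedM|exact: directed_inj].
- exists (@max_lift G S rho a b rhoM); split.
  + by move=> M; exact: max_lift_maximal.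
  + by move=> M N /set_mem MN /set_mem NN; exact: max_lift_inj.
- exact: Gam_finitely_generated.
Qed.

(** The derived subgroup is normal in a simple group, and nontrivial because the group is not
    solvable. *)
Lemma Alt5_perfect : perfect_group (subg_of 'Alt_('I_5)).
Proof.
have sA : solvable 'Alt_('I_5) = false by apply: solvable_AltF; rewrite card_ord.
have /simpleP[_ maxA] : simple 'Alt_('I_5) by apply: simple_Alt5; rewrite card_ord.
have RA : ([~: 'Alt_('I_5), 'Alt_('I_5)] = 'Alt_('I_5))%g.
  have [|//] := maxA [~: 'Alt_('I_5), 'Alt_('I_5)]%G (der_normal 1 _).
  by move/commG1P/abelian_sol; rewrite sA.
have im := im_subg 'Alt_('I_5).
have : ([~: subg 'Alt_('I_5) @* 'Alt_('I_5), subg 'Alt_('I_5) @* 'Alt_('I_5)]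
          = subg 'Alt_('I_5) @* 'Alt_('I_5))%g.
  by rewrite -morphimR // RA.
by rewrite im.
Qed.

Lemma Alt5_gt1 : 1 < #|{: subg_of 'Alt_('I_5)}|.
Proof.
rewrite -cardsT -im_subg card_injm ?injm_subg // ltnNge -(leq_pmul2l (isT : 0 < 2)).
by rewrite card_Alt card_ord.
Qed.

(** [idx n] decodes the 2-adic valuation of [n], and every valuation occurs at arbitrarily large
    [n]. *)
Lemma multiplicity_seq (I : countType) (i0 : I) (P : pred I) : P i0 ->
  exists2 idx : nat -> I, forall n, P (idx n) &
    forall i n, P i -> exists2 m, n <= m & idx m = i.
Proof.
move=> Pi0.
exists (fun n =>
  if @choice.unpickle I (logn 2 n) is Some i then if P i then i else i0 else i0).
  by move=> n; case: (choice.unpickle _) => // i; case: ifP.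
move=> i n Pi; exists (2 ^ choice.pickle i * (n.*2).+1)%N.
  apply: (@leq_trans (n.*2).+1); first by rewrite -addnn leqW ?leq_addr.
  by rewrite leq_pmull // expn_gt0.
have -> : logn 2 (2 ^ choice.pickle i * (n.*2).+1) = choice.pickle i.
  rewrite lognM ?expn_gt0 // pfactorK // -[RHS]addn0; congr addn.
  by apply/eqP; rewrite -leqn0 leqNgt logn_gt0 mem_primes /= dvdn2 /= odd_double.
by rewrite choice.pickleK Pi.
Qed.

Theorem mainTheorem1 (G : groupType)
    (hG : countably_based_residually_finite_perfect G) :
  exists (A : choiceType) (X : nat -> {fset A}) (Gamma : set (tree_aut X)),
    [/\ tree_alphabets X,
        layered_branch_group Gamma,
        (exists H : set (tree_aut X),
            [/\ is_subgroup H, H `<=` Gamma & isomorphic_to G H]),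
        (exists F : set G -> set (tree_aut X),
            let nonnormal_maximal :=
              [set K | maximal_subgroup [set: G] K /\ ~ normal_in [set: G] K] in
            set_fun nonnormal_maximal (maximal_subgroup Gamma) F /\
            set_inj nonnormal_maximal F) &
        (finitely_generated [set: G] -> finitely_generated Gamma)].
Proof.
have [I [S [phi [[Sp phi_surj] phi_inj]]]] := hG.
have phiM i : {morph (fun g => phi g i) : g h / g * h}.
  by move=> g h; rewrite gmulfM.
have [[i0 Si0]|/forallNP S_triv] := pselect (exists i, 1 < #|S i|).
  have [idx S_idx idx_inf] := multiplicity_seq (P := fun i => 1 < #|S i|) Si0.
  refine (@layered_branch_overgroup G (fun n => S (idx n))
    (fun n g => phi g (idx n)) (fun n => phiM (idx n))
    (fun n => phi_surj (idx n)) _ (fun n => Sp (idx n)) S_idx).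
  move=> n g g1; apply: phi_inj; apply: functional_extensionality_dep => i.
  rewrite [RHS](group_morph1 (phiM i)).
  (* A nontrivial factor recurs beyond [n], where [g1] applies; in a trivial one any two elements
     agree. *)
  have [Si|] := ltnP 1 #|S i|; first by have [m nm <-] := idx_inf i n Si; exact: g1.
  by move/card_le1_eqP; apply.
have G1 (g h : G) : g = h.
  apply: phi_inj; apply: functional_extensionality_dep => i.
  have /negP := S_triv i; rewrite -leqNgt => /card_le1_eqP; exact.
have [|||||A [X [Gamma [XP GP _ _ GF]]]] :=
  @layered_branch_overgroup (subg_of 'Alt_('I_5)) (fun=> subg_of 'Alt_('I_5))
    (fun=> id).
- by [].
- by move=> n s; exists s.
- by move=> n g /(_ n (leqnn n)).
- by move=> n; exact: Alt5_perfect.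
- by move=> n; exact: Alt5_gt1.
(* The trivial group [G] embeds as the identity and has no maximal subgroup; finite generation comes
   from the finite alternating group. *)
exists A, X, Gamma; split=> //.
- have [[Gs _ _] _] := GP; have [Gamma1 _ _] := Gs.
  pose f (g : G) : tree_aut X := 1.
  have fM : {morph f : g h / g * h} by move=> g h; rewrite /f mulg1.
  exists (range f); split; first exact: range_is_subgroup.
    by move=> _ [g _ <-].
  by apply: image_isomorphic => // g h _.
- have nomax K : ~ maximal_subgroup [set: G] K.
    by move=> [[K1 _ _] [_ KT] _]; apply: KT => g _; rewrite (G1 g 1).
  exists (fun=> set0); split=> [K [/nomax]//|K L /set_mem[/nomax]].
  by [].
- move=> _; apply: GF; exists setT; first exact: finite_finset.
  by apply/seteqP; split=> // g _; exact: sub_generated.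
Qed.
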